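(* Let $n\ge1$, let $G$ be a ciliated bipartite graph embedded in $\mathbb{R}^2$ with a choice of Kasteleyn signs $\epsilon$, and let $\Phi_q$ be an edge-commuting $n\times n$ quantum connection on $G$ with entries in an algebra $\mathbb{A}$. Then, up to a global sign, the quantum partition function equals the $q$-Kasteleyn determinant: $$Z_q(\Phi_q)=\pm\,\mathrm{Kdet}_q(\Phi_q)\in\mathbb{A}.$$
   Context: Parameters. $n\ge1$; $q\in\mathbb{C}\setminus\{0\}$ is not a $(2m)$-th root of unity for $m=2,\dots,n$, except that $q=\pm1$ is allowed. $[k]=\sum_{i=1}^kq^{-k-1+2i}$, $[k]!=[k]\cdots[1]$, $[0]!=1$. $\ell(\sigma)$ is the number of inversions of a permutation. Graphs. $G$ is a finite bipartite graph, $V=B\cup W$, $B=\{b_1,\dots,b_N\}$, $W=\{w_1,\dots,w_N\}$, edge set $E$, multiple edges allowed, embedded in the plane, having at least one perfect matching, and such that every edge lies in some perfect matching (in particular the components of $G$ are 2-connected). A ciliation is the choice of a cilium at each vertex, pointing into a corner between half-edges; it orders the half-edges at the vertex linearly, starting just after the cilium, counterclockwise at black and clockwise at white vertices. Faces are bounded faces; face conditions are read on each connected component. Kasteleyn signs: $\epsilon:E\to\{\pm1\}$ such that for every face with $l$ edges and $k$ cilia pointing into it the product of $\epsilon(e)$ over the edges of the face is $(-1)^{l/2-1}$ if $n$ is odd and $(-1)^{l/2-1-k}$ if $n$ is even. Quantum matrices and connections. An $n\times n$ matrix $M=(M_{ij})$ over a unital $\mathbb{C}$-algebra is a quantum matrix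 if for all $i<k$, $j<l$ the entries $a=M_{ij}$, $b=M_{il}$, $c=M_{kj}$, $d=M_{kl}$ satisfy $ab=qba$, $cd=qdc$, $ac=qca$, $bd=qdb$, $bc=cb$, $ad-da=(q-q^{-1})bc$. An edge-commuting quantum connection $\Phi_q$ assigns to each edge $e\in E$ an $n\times n$ quantum matrix $\Phi_q(e)$ with entries in $\mathbb{A}$ such that all entries of $\Phi_q(e)$ commute with all entries of $\Phi_q(e')$ for $e\ne e'$; $\mathbb{A}$ is the $\mathbb{C}$-algebra generated by these entries. Multiwebs and trace. $\Omega_n$ is the set of functions $m:E\to\{0,\dots,n\}$, $e\mapsto m_e$, with $\sum_{e\ni v}m_e=n$ for all $v\in V$. For $m\in\Omega_n$ let $G_m$ be the ciliated plane graph obtained by replacing each edge $e$ by $m_e$ parallel copies (none if $m_e=0$), with no cilium between copies; each copy $e'$ of $e$ carries $\Phi_q(e')=\Phi_q(e)$. For a white vertex $w$ let $e'_{w,1},\dots,e'_{w,n}$ be the edges of $G_m$ at $w$ in the linear order; if $e'=e'_{w,k}$ has black endpoint $b(e')$, let $p(e')$ be its position in the linear order at $b(e')$. Contracting quantum codeterminants $\sum_\sigma(-q)^{\ell(\sigma)}x_{\sigma(1)}\otimes\cdots\otimes x_{\sigma(n)}$ at black vertices and $\sum_\sigma(-q)^{\ell(\sigma)}x^*_{\sigma(1)}\otimes\cdots\otimes x^*_{\sigma(n)}$ at white vertices along the connection gives $$\mathrm{tr}_q(\Phi_q(G_m),G_m)=\sum_{(\sigma_v)_{v\in V}\in\mathfrak{S}_n^V}\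 \prod_{v\in V}(-q)^{\ell(\sigma_v)}\ \prod_{w\in W}\Bigl(A_{w,1}A_{w,2}\cdots A_{w,n}\Bigr),\qquad A_{w,k}=\Phi_q(e'_{w,k})_{\sigma_w(k),\,\sigma_{b(e'_{w,k})}(p(e'_{w,k}))}$$ (factors at different white vertices commute). Then $$\mathrm{tr}_q(\Phi_q,m)=\frac{\mathrm{tr}_q(\Phi_q(G_m),G_m)}{\prod_{e\in E}[m_e]!},\qquad Z_q(\Phi_q)=q^{-N\binom n2}\sum_{m\in\Omega_n}\mathrm{tr}_q(\Phi_q,m).$$ $q$-Kasteleyn determinant. The blow-up graph $\tilde G$ has vertices $\tilde b_{j,k}$, $\tilde w_{i,l}$ ($1\le i,j\le N$, $1\le k,l\le n$), and for each edge $e$ of $G$ from $b_j$ to $w_i$ it has $n^2$ edges $\tilde e$ over $e$, one joining each $\tilde b_{j,k}$ to each $\tilde w_{i,l}$; such an edge carries $\tilde\Phi_q(\tilde e)=\Phi_q(e)_{lk}$. Order black (resp. white) vertices of $\tilde G$ lexicographically: $\tilde w_{n(i-1)+l}=\tilde w_{i,l}$, $\tilde b_{n(j-1)+k}=\tilde b_{j,k}$. Let $\tilde\Omega_1$ be the set of perfect matchings of $\tilde G$. To $\tilde m\in\tilde\Omega_1$ associate: - $\tilde\sigma\in\mathfrak{S}_{Nn}$ with $\tilde w_{\tilde i}$ matched to $\tilde b_{\tilde\sigma(\tilde i)}$ by an edge $\tilde e_{\tilde i\tilde\sigma(\tilde i)}$ of $\tilde m$, lying over an edge $e_{\tilde i\tilde\sigma(\tilde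 i)}$ of $G$; $(-1)^{\tilde\sigma}$ is its signature; - multiplicities $m_e$ = number of edges of $\tilde m$ over $e$; - for each edge $e$ from $b_j$ to $w_i$ the subsets $T_e$ (resp. $S_e$) of $\{1,\dots,n\}$ of size $m_e$ of indices $k$ (resp. $l$) such that an edge of $\tilde m$ over $e$ is attached to $\tilde b_{j,k}$ (resp. $\tilde w_{i,l}$); - for each $v\in V$ the permutation $\sigma_v\in\mathfrak{S}_n$ obtained by listing, in the linear order of half-edges at $v$, the subsets ($S_e$ if $v$ is white, $T_e$ if $v$ is black) attached to them, each subset in increasing order; - for each $e$ the permutation $\sigma_e=g_e\circ h_e\circ f_e^{-1}\in\mathfrak{S}_{m_e}$, where $f_e:S_e\to\{1,\dots,m_e\}$ and $g_e:T_e\to\{1,\dots,m_e\}$ are the increasing bijections and $h_e:S_e\to T_e$ sends $l$ to the $k$ such that $\tilde w_{i,l}$, $\tilde b_{j,k}$ are joined by an edge of $\tilde m$ over $e$. Then $$\mathrm{Kdet}_q(\Phi_q)=q^{-N\binom n2}\sum_{\tilde m\in\tilde\Omega_1}(-1)^{\tilde\sigma}\Bigl(\prod_{v\in V}q^{\ell(\sigma_v)}\Bigr)\Bigl(\prod_{e\in E}q^{\binom{m_e}2}q^{\ell(\sigma_e)}\Bigr)\Bigl(\prod_{\tilde i=1}^{Nn}\epsilon(e_{\tilde i\tilde\sigma(\tilde i)})\Bigr)\tilde\Phi_q(\tilde e_{1\tilde\sigma(1)})\tilde\Phi_q(\tilde e_{2\tilde\sigma(2)})\cdots\tilde\Phi_q(\tilde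 e_{Nn\,\tilde\sigma(Nn)}).$$ *)

(* Defs.v *)
From mathcomp Require Import all_boot all_order all_fingroup all_algebra.
From mathcomp Require Import reals complex.

Set Implicit Arguments.
Unset Strict Implicit.
Unset Printing Implicit Defensive.

Import Order.TTheory GRing.Theory Num.Theory.
Local Open Scope ring_scope.

Definition inv_count (n : nat) (s : 'S_n) : nat :=
  #|[set p : 'I_n * 'I_n | (p.1 < p.2)%N && (s p.2 < s p.1)%N]|.

(* The permutation with underlying function [f]; the identity is a dummy
   value for non-injective [f]. *)
Definition mkperm (T : finType) (f : T -> T) : {perm T} :=
  insubd (1%g : {perm T}) (finfun f).

(* The permutation whose one-line notation is [s], for a list [s] of length
   [n] without repetition (the default value of [nth] is then unused). *)
Definition perm_of_list (n : nat) (s : seq 'I_n) : 'S_n :=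
  mkperm (fun k : 'I_n => nth k s k).

(* A bipartite multigraph with black vertices b_0 .. b_(N-1) and white
   vertices w_0 .. w_(N-1).  The drawing in the plane and the cilia are
   recorded by listing the half-edges at each vertex from its cilium on:
   [bord G b] lists the edges at [b] in counterclockwise order, [word G w]
   lists those at [w] in clockwise order. *)
Record cgraph (N : nat) := CGraph {
  edge : finType;
  bl : edge -> 'I_N;
  wh : edge -> 'I_N;
  bord : 'I_N -> seq edge;
  word : 'I_N -> seq edge
}.

Definition ciliated (N : nat) (G : cgraph N) : Prop :=
  (forall b : 'I_N,
     uniq (bord G b) /\ forall e, (e \in bord G b) = (bl e == b)) /\
  (forall w : 'I_N,
     uniq (word G w) /\ forall e, (e \in word G w) = (wh e == w)).

Section Graph.
Variables (N : nat) (G : cgraph N).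

(* [inl b] is a black vertex, [inr w] a white vertex. *)
Definition vertex : finType := ('I_N + 'I_N)%type.

Definition incident (e : edge G) (v : vertex) : bool :=
  match v with inl b => bl e == b | inr w => wh e == w end.

Definition half_edges (v : vertex) : seq (edge G) :=
  match v with inl b => bord G b | inr w => word G w end.

Definition adj : rel vertex :=
  [rel u v | (u != v) && [exists e, incident e u && incident e v]].

Definition perfect_matching (M : {set edge G}) : bool :=
  [forall v, #|[set e in M | incident e v]| == 1%N].

Definition matching_covered : Prop :=
  (exists M, perfect_matching M) /\
  (forall e, exists2 M, perfect_matching M & e \in M).

(* A dart is an edge with a direction: [(e, true)] leaves the black end of
   [e], [(e, false)] its white end. *)
Definition dart : finType := (edge G * bool)%type.

Definition origin (d : dart) : vertex :=
  if d.2 then inl (bl d.1) else inr (wh d.1).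

(* The dart following [d] on the boundary of the face to the left of [d]:
   go along [d], then take the next half-edge in clockwise order, i.e. the
   next one in the list of a white vertex, the previous one in the list of a
   black vertex (both read cyclically). *)
Definition face_next (d : dart) : dart :=
  if d.2 then (next (word G (wh d.1)) d.1, false)
  else (prev (bord G (bl d.1)) d.1, true).

Definition face_of (d : dart) : {set dart} :=
  [set d' | fconnect face_next d d'].

Definition faces : {set {set dart}} := [set face_of d | d : dart].

(* The face to the left of [d] contains the corner at [origin d] lying just
   counterclockwise of [d].  The cilium points into that corner when [d] is
   the last half-edge of a black vertex (listed counterclockwise) or the
   first one of a white vertex (listed clockwise). *)
Definition cilium_corner (d : dart) : bool :=
  if d.2 then d.1 == last d.1 (bord G (bl d.1))
  else d.1 == head d.1 (word G (wh d.1)).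

(* A graph embedded in the plane, as a combinatorial map: the rotation system
   has genus 0 on each component (Euler's formula, where [faces] counts the
   faces of each component separately), and [outer] is the set of unbounded
   faces, one for each component. *)
Definition plane (outer : {set {set dart}}) : Prop :=
  [/\ (#|vertex| + #|faces| = #|edge G| + 2 * n_comp adj predT)%N,
      outer \subset faces
    & forall v : vertex,
        #|[set F in outer | [exists d in F, connect adj v (origin d)]]|
          = 1%N].

Definition kasteleyn (n : nat) (outer : {set {set dart}})
    (eps : edge G -> int) : Prop :=
  (forall e, eps e = 1 \/ eps e = -1) /\
  forall F, F \in faces :\: outer ->
    let l := #|F| in
    let k := #|[set d in F | cilium_corner d]| in
    \prod_(d in F) eps d.1 =
      if odd n then (-1) ^ (l./2%:Z - 1) else (-1) ^ (l./2%:Z - 1 - k%:Z).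

Definition multiweb (n : nat) (m : {ffun edge G -> 'I_n.+1}) : bool :=
  [forall v : vertex, (\sum_(e | incident e v) m e == n)%N].

(* G_m.  Parallel copies meet their two ends in the same order, since the
   lists are counterclockwise at black and clockwise at white vertices. *)
Definition copies (m : edge G -> nat) : finType := {e : edge G & 'I_(m e)}.

Definition copies_list (m : edge G -> nat) (s : seq (edge G)) :
    seq (copies m) :=
  flatten [seq [seq Tagged (fun e => 'I_(m e)) c | c <- enum 'I_(m e)]
          | e <- s].

Definition multiply (m : edge G -> nat) : cgraph N :=
  {| edge := copies m;
     bl := fun e' => bl (tag e');
     wh := fun e' => wh (tag e');
     bord := fun b => copies_list m (bord G b);
     word := fun w => copies_list m (word G w) |}.

End Graph.

Section Quantum.
Variable R : realType.
Implicit Types q : R[i].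

Definition admissible q (n : nat) : Prop :=
  q != 0 /\
  (q = 1 \/ q = -1 \/ forall m : nat, (2 <= m <= n)%N -> q ^+ (2 * m) != 1).

Definition qint q (k : nat) : R[i] :=
  \sum_(1 <= i < k.+1) q ^ (- k%:Z - 1 + 2 * i%:Z).

Definition qfact q (k : nat) : R[i] := \prod_(1 <= i < k.+1) qint q i.

Variable A : algType R[i].

Definition quantum_matrix q (n : nat) (M : 'M[A]_n) : Prop :=
  forall i k j l : 'I_n, (i < k)%N -> (j < l)%N ->
    let a := M i j in let b := M i l in let c := M k j in let d := M k l in
    [/\ a * b = q *: (b * a), c * d = q *: (d * c),
        a * c = q *: (c * a) & b * d = q *: (d * b)] /\
    (b * c = c * b /\ a * d - d * a = (q - q^-1) *: (b * c)).

Definition quantum_connection q (n N : nat) (G : cgraph N)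
    (Phi : edge G -> 'M[A]_n) : Prop :=
  (forall e, quantum_matrix q (Phi e)) /\
  (forall e e', e != e' -> forall i j k l,
     Phi e i j * Phi e' k l = Phi e' k l * Phi e i j).

(* The trace is used for graphs all of whose vertices have degree [n], so that
   the default values (0 for a missing k-th edge, [k] for a position which is
   not smaller than [n]) do not occur. *)
Definition trace_entry (n N : nat) (H : cgraph N) (Psi : edge H -> 'M[A]_n)
    (s : {ffun vertex N -> 'S_n}) (w : 'I_N) (k : 'I_n) : A :=
  if onth (word H w) k is Some e' then
    Psi e' (s (inr w) k)
           (s (inl (bl e')) (insubd k (index e' (bord H (bl e')))))
  else 0.

Definition trace_graph q (n N : nat) (H : cgraph N)
    (Psi : edge H -> 'M[A]_n) : A :=
  \sum_(s : {ffun vertex N -> 'S_n})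
    (\prod_(v : vertex N) (- q) ^+ inv_count (s v)) *:
    \prod_(w < N) \prod_(k < n) trace_entry Psi s w k.

Definition trace_multiweb q (n N : nat) (G : cgraph N)
    (Phi : edge G -> 'M[A]_n) (m : {ffun edge G -> 'I_n.+1}) : A :=
  (\prod_(e : edge G) qfact q (m e))^-1 *:
  trace_graph q (H := multiply (fun e => m e)) (fun e' => Phi (tag e')).

Definition Zq q (n N : nat) (G : cgraph N) (Phi : edge G -> 'M[A]_n) : A :=
  q ^- (N * 'C(n, 2)) *:
  \sum_(m : {ffun edge G -> 'I_n.+1} | multiweb m) trace_multiweb q Phi m.

End Quantum.

Section BlowUp.
Variables (n N : nat) (G : cgraph N).

(* The blow-up graph.  Its black and its white vertices are both indexed by
   pairs (vertex of G, index in 'I_n), ordered lexicographically. *)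
Definition tvertex : finType := ('I_N * 'I_n)%type.

(* [(e, k, l)] is the edge over [e] with black index [k] and white index [l]. *)
Definition tedge : finType := (edge G * 'I_n * 'I_n)%type.
Definition tover (t : tedge) : edge G := t.1.1.
Definition tb (t : tedge) : 'I_n := t.1.2.
Definition tw (t : tedge) : 'I_n := t.2.

Definition tbl (t : tedge) : tvertex := (bl (tover t), tb t).
Definition twh (t : tedge) : tvertex := (wh (tover t), tw t).

Definition tmatching (m : {set tedge}) : bool :=
  [forall x : tvertex, (#|[set t in m | tbl t == x]| == 1%N)
                    && (#|[set t in m | twh t == x]| == 1%N)].

Variable m : {set tedge}.

(* The edge of the matching [m] at the white vertex [x]. *)
Definition mate (x : tvertex) : option tedge := [pick t in m | twh t == x].

(* Black and white vertices being numbered in the same way, the signature of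
   this permutation of pairs is that of the permutation of the numbers. *)
Definition tsigma : {perm tvertex} := mkperm (fun x => oapp tbl x (mate x)).

Definition mult (e : edge G) : nat := #|[set t in m | tover t == e]|.

Definition T_ (e : edge G) : {set 'I_n} := [set tb t | t in m & tover t == e].
Definition S_ (e : edge G) : {set 'I_n} := [set tw t | t in m & tover t == e].

(* [enum] lists a subset of ['I_n] in increasing order. *)
Definition vsigma (v : vertex N) : 'S_n :=
  perm_of_list (flatten
    [seq enum (if v is inl _ then T_ e else S_ e) | e <- half_edges G v]).

Definition hmap (e : edge G) (l : 'I_n) : 'I_n :=
  oapp tb l [pick t in m | (tover t == e) && (tw t == l)].

(* In a matching #|S_ e| = #|T_ e| = mult e; [enum_val] is the increasing
   bijection from ['I_#|S_ e|] to [S_ e], and [index _ (enum (T_ e))] gives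
   the increasing bijection from [T_ e] to its ranks. *)
Definition esigma (e : edge G) : 'S_#|S_ e| :=
  mkperm (fun a : 'I_#|S_ e| =>
    insubd a (index (hmap e (enum_val a)) (enum (T_ e)))).

End BlowUp.

Section Kdet.
Variables (R : realType) (A : algType R[i]).

(* The product over the white vertices of the blow-up is non-commutative and
   taken in lexicographic order; in a perfect matching [mate] is always
   defined. *)
Definition Kdet (q : R[i]) (n N : nat) (G : cgraph N) (eps : edge G -> int)
    (Phi : edge G -> 'M[A]_n) : A :=
  q ^- (N * 'C(n, 2)) *:
  \sum_(m : {set tedge n G} | tmatching m)
    ((-1) ^+ (tsigma m : bool)
     * (\prod_(v : vertex N) q ^+ inv_count (vsigma m v))
     * (\prod_(e : edge G) (q ^+ 'C(mult m e, 2)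
                            * q ^+ inv_count (esigma m e)))
     * (\prod_(x : tvertex n N)
          oapp (fun t => (eps (tover t))%:~R) 1 (mate m x))) *:
    \prod_(i < N) \prod_(l < n)
      oapp (fun t => Phi (tover t) (tw t) (tb t)) 0 (mate m (i, l)).

End Kdet.

(* Main.v *)
(** Both sides are sums over the perfect matchings of the blow-up graph.

    Summing over the colourings of the black ends, exchanging the colours of
    two adjacent copies of an edge at its white end multiplies the result by
    [q^2] (a relation in a quantum 2 x 2 minor).  Sorting the colours of the
    copies of [e] therefore produces the factor [q^C(m_e, 2) [m_e]!], and the
    sorted colourings of [G_m] are the matchings of the blow-up lying over
    [m].  This turns [Zq] into a sum over matchings whose coefficients differ
    from those of [Kdet] by signs only.

    The sign attached to a matching depends only on [m]: writing [tsigma] as a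
    comparison of two orders on the edges of the matching, it is
    [(-1)^(Q m + L m)] in which [Q] is the quadratic form over F_2 counting
    pairs of edges ordered differently at their white and at their black ends,
    and [L] is the linear form given by [eps].  Adding to [m] the boundary of a
    face with [l] edges and [k] cilia changes [Q] by [l/2 - 1 + k + n k] (valid
    for every face, a simple cycle or not), hence [Q + L] is unchanged for
    bounded faces by the Kasteleyn condition.  By Euler's formula the
    boundaries of the bounded faces span the cycle space mod 2, so that any two
    multiwebs have the same sign. *)

Require Import Defs.
From mathcomp Require Import all_boot all_order all_fingroup all_algebra.
From mathcomp Require Import reals complex.
From mathcomp Require Import zify ring.

Set Implicit Arguments.
Unset Strict Implicit.
Unset Printing Implicit Defensive.

Import GRing.Theory.
Local Open Scope ring_scope.

(** * Comparing two orders modulo 2 *)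

(** The exchange at a white end fails term by term. Only after the two black colourings of the
    copies are added do the four products form [da - q^-1 cb] and [ad - q bc], two expressions of
    one quantum determinant. Hence [row_sum] sums over black colourings first and sorting takes
    place at white ends only. The black colours of the copies of an edge stay free; compared with
    the sorted white colours they give [esigma].

    Signs are studied on functions with values in F_2 because a multiweb plus the boundary of a face
    need not be a multiweb. What persists is the vertex sum [n] modulo 2, and the polar form of Q
    needs no more: it produces the term [n k] ([polar_face]), while Q of the boundary itself
    produces [l/2 - 1 + k] ([quad_face]). In both computations the white and the black order
    contribute separately, each being read at the corners of its own colour, so that only cilia
    leave a trace. *)

Lemma F2_addxx (x : 'F_2) : x + x = 0.
Proof. by apply: addrr_pchar2; rewrite pchar_Fp. Qed.

Lemma F2_opp (x : 'F_2) : - x = x.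
Proof. by apply: oppr_pchar2; rewrite pchar_Fp. Qed.

Lemma F2_natr (k : nat) : (k%:R : 'F_2) = (odd k)%:R.
Proof.
rewrite -[in LHS](odd_double_half k) natrD -mul2n natrM.
by rewrite (pchar_Fp_0 (isT : prime 2)) mul0r addr0.
Qed.

Lemma F2_addb (b c : bool) : ((b (+) c)%:R : 'F_2) = b%:R + c%:R.
Proof. by case: b; case: c => //=; rewrite ?addr0 ?add0r // F2_addxx. Qed.

Lemma F2_odd_inj (j k : nat) : (j%:R : 'F_2) = k%:R -> odd j = odd k.
Proof. by rewrite (F2_natr j) (F2_natr k); case: (odd j); case: (odd k). Qed.

Section Tournament.
Variable T : finType.
Implicit Types r : rel T.

Definition tournament r := forall x y, r y x = (x != y) && ~~ r x y.

Definition discord r r' : 'F_2 := \sum_x \sum_y (r x y && r' y x)%:R.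

Let differ r r' (x y : T) : 'F_2 := (r x y)%:R + (r' x y)%:R.

Lemma tournament_irr r x : tournament r -> r x x = false.
Proof. by move=> tr; rewrite tr eqxx. Qed.

Lemma tournament_comp r (s : {perm T}) :
  tournament r -> tournament (fun x y => r (s x) (s y)).
Proof. by move=> tr x y; rewrite tr (inj_eq perm_inj). Qed.

Lemma differC r r' x y :
  tournament r -> tournament r' -> differ r r' x y = differ r r' y x.
Proof.
move=> tr tr'; rewrite /differ (tr x y) (tr' x y); case: (eqVneq x y) => [->|_].
  by rewrite !tournament_irr.
by case: (r x y); case: (r' x y); rewrite //= ?F2_addxx ?addr0 ?add0r.
Qed.

(** A tournament selects one of [(x, y)] and [(y, x)] for each pair of distinct points, and a
    symmetric summand does not see which one. *)
Lemma sum_tournament (V : zmodType) (g : T -> T -> V) r r' :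
    tournament r -> tournament r' -> (forall x y, g x y = g y x) ->
  \sum_x \sum_(y | r x y) g x y = \sum_x \sum_(y | r' x y) g x y.
Proof.
move=> tr tr' gC.
have split r1 r2 : \sum_x \sum_(y | r1 x y) g x y =
    \sum_x \sum_(y | r1 x y && r2 x y) g x y +
    \sum_x \sum_(y | r1 x y && ~~ r2 x y) g x y.
  by rewrite -big_split; apply: eq_bigr => x _; rewrite (bigID (r2 x)).
rewrite (split r r') (split r' r); congr (_ + _).
  by apply: eq_bigr => x _; apply: eq_bigl => y; rewrite andbC.
rewrite (exchange_big_dep xpredT) //=; apply: eq_bigr => x _.
rewrite (eq_bigr (g x)) => [|y _]; last exact: gC.
apply: eq_bigl => y; rewrite (tr x y) (tr' x y).
case: (eqVneq x y) => [->|_]; last by rewrite andbC negbK.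
by rewrite !tournament_irr.
Qed.

(** The choice of [r0] is free, so several discords can be summed over the same pairs; this makes
    [discord] additive in [discord_trans]. *)
Lemma discordE r0 r r' : tournament r0 -> tournament r -> tournament r' ->
  discord r r' = \sum_x \sum_(y | r0 x y) differ r r' x y.
Proof.
move=> t0 tr tr'.
rewrite (sum_tournament t0 tr) => [|x y]; last exact: differC.
apply: eq_bigr => x _; rewrite [RHS]big_mkcond; apply: eq_bigr => y _.
rewrite (tr' x y) /differ; case rxy: (r x y) => //=.
have -> /= : x != y by apply: contraTneq rxy => ->; rewrite tr eqxx.
by case: (r' x y); rewrite ?F2_addxx ?addr0.
Qed.

Lemma discord_trans r1 r2 r3 :
    tournament r1 -> tournament r2 -> tournament r3 ->
  discord r1 r3 = discord r1 r2 + discord r2 r3.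
Proof.
move=> t1 t2 t3; rewrite !(@discordE r1) // -big_split; apply: eq_bigr => x _.
rewrite -big_split; apply: eq_bigr => y _ /=.
by rewrite /differ -addrA (addrA (r2 x y)%:R) F2_addxx add0r.
Qed.

Lemma discord_comp r r' (s : {perm T}) :
  discord (fun x y => r (s x) (s y)) (fun x y => r' (s x) (s y)) = discord r r'.
Proof.
rewrite [RHS](reindex_inj (@perm_inj _ s)); apply: eq_bigr => x _.
by rewrite [RHS](reindex_inj (@perm_inj _ s)).
Qed.

(** A third point contributes equally through its pairs with [x] and with [y], so modulo 2 only the
    pair of [x] and [y] counts. *)
Lemma discord_tperm r x y : tournament r -> x != y ->
  discord r (fun u v => r (tperm x y u) (tperm x y v)) = 1.
Proof.
move=> tr nxy; have tr' := tournament_comp (tperm x y) tr.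
(* [r0] puts [x] before everything else and [y] right after it. *)
pose r0 : rel T := fun u v =>
  if u == x then v != x else if v == x then false
  else if u == y then v != y else if v == y then false else r u v.
have t0 : tournament r0.
  move=> u v; rewrite /r0; case: (eqVneq u x) => [->|nux].
    by rewrite eq_sym; case: (eqVneq v x).
  case: (eqVneq v x) => [->|nvx]; first by rewrite nux.
  case: (eqVneq u y) => [->|nuy]; first by rewrite eq_sym; case: (eqVneq v y).
  by case: (eqVneq v y) => [->|nvy]; rewrite ?nuy // tr.
rewrite (discordE t0) //; set g := differ _ _.
have gz z : z != x -> z != y -> g x z = g y z.
  move=> zx zy; rewrite /g /differ tpermL tpermR tpermD 1?eq_sym //.
  by rewrite addrC.
have g0 u v : u != x -> u != y -> v != x -> v != y -> g u v = 0.
  by move=> *; rewrite /g /differ !tpermD 1?eq_sym // F2_addxx.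
rewrite (bigD1 x) //= [X in _ + X](bigD1 y) 1?eq_sym //= [X in _ + (_ +
  X)]big1; last first.
  move=> u /andP[ux uy]; rewrite big1 // => v; rewrite /r0 (negPf ux) (negPf uy).
  by case: (eqVneq v x) => // vx; case: (eqVneq v y) => // vy _; apply: g0.
rewrite addr0 (bigD1 y) /=; last by rewrite /r0 eqxx eq_sym.
have -> : \sum_(v | r0 y v) g y v = \sum_(v | r0 x v && (v != y)) g x v.
  rewrite /r0 eqxx (negPf (_ : y != x)) 1?eq_sym // eqxx.
  rewrite (eq_bigl (fun v => (v != x) && (v != y))) => [|v]; last by case: eqP.
  by apply: eq_bigr => v /andP[? ?]; rewrite gz.
rewrite -addrA F2_addxx addr0 /g /differ tpermL tpermR (tr x y) nxy.
by case: (r x y); rewrite ?addr0 ?add0r.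
Qed.

(** Each transposition of a decomposition contributes 1, since discord is additive and invariant
    under relabelling. *)
Lemma odd_perm_discord r (s : {perm T}) : tournament r ->
  (odd_perm s)%:R = discord r (fun x y => r (s x) (s y)).
Proof.
move=> tr; case: (prod_tpermP s) => ts -> {s}.
elim: ts => [|[x y] ts IHts] /=.
  rewrite big_nil odd_perm1 /discord big1 // => x _; rewrite big1 // => y _.
  by rewrite !perm1 (tr x y); case: (r x y); rewrite ?andbF.
move=> /andP[nxy /IHts{IHts}]; rewrite big_cons /=.
set s := (\prod_(t <- ts) _)%g => IH.
rewrite odd_permM odd_tperm nxy F2_addb IH -(discord_tperm tr nxy).
rewrite [RHS](@discord_trans _ (fun u v => r (tperm x y u) (tperm x y v))) //.
- congr (_ + _); rewrite -(discord_comp r _ (tperm x y)).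
  by apply: eq_bigr => u _; apply: eq_bigr => v _; rewrite !permM.
- exact: tournament_comp.
- exact: tournament_comp.
Qed.

End Tournament.

Lemma index_next (T : eqType) (s : seq T) (x : T) : uniq s -> x \in s ->
  index (next s x) s =
    if (index x s).+1 == size s then 0%N else (index x s).+1.
Proof.
move=> us xs; rewrite next_nth xs; case: s us xs => // y s us xs.
set i := index x _; have : (i < size (y :: s))%N by rewrite index_mem.
rewrite ltnS leq_eqVlt eqSS; case: eqVneq => [-> _ | _ lt_i].
  by rewrite nth_default //= eqxx.
by rewrite -[nth y s i]/(nth y (y :: s) i.+1) index_uniq.
Qed.

Section Lexicographic.
Variable T : eqType.

Definition lexr (f : T -> nat) (r : rel T) : rel T :=
  fun x y => (f x < f y)%N || ((f x == f y) && r x y).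

Lemma lexr_asym (f : T -> nat) (r : rel T) x y :
    (f x = f y -> r y x = (x != y) && ~~ r x y) ->
  lexr f r y x = (x != y) && ~~ lexr f r x y.
Proof.
rewrite /lexr eq_sym; case: (ltngtP (f x) (f y)) => //= [lt|lt|-> -> //] _.
  by rewrite andbF.
by rewrite andbT; symmetry; apply: contraTneq lt => ->; rewrite ltnn.
Qed.

Lemma ltn_asym (f : T -> nat) x y : (f x = f y -> x = y) ->
  (f y < f x)%N = (x != y) && ~~ (f x < f y)%N.
Proof.
move=> inj; case: (eqVneq x y) => [->|nxy] /=; first by rewrite ltnn.
rewrite -leqNgt [RHS]leq_eqVlt eq_sym; case: eqVneq => // /inj xy.
by rewrite xy eqxx in nxy.
Qed.
End Lexicographic.

(** * The quadratic form of two orders over F_2 *)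

Section QuadraticForm.
Variables (E : finType) (r r' : rel E).
Implicit Types x y : E -> 'F_2.

Definition quad x : 'F_2 := \sum_e \sum_f x e * x f * (r e f && r' f e)%:R.

Lemma eq_quad x y : x =1 y -> quad x = quad y.
Proof.
by move=> xy; apply: eq_bigr => e _; apply: eq_bigr => f _; rewrite !xy.
Qed.

Definition polar x y : 'F_2 :=
  \sum_e \sum_f x e * y f * ((r e f)%:R + (r' e f)%:R).

Hypotheses (tr : tournament r) (tr' : tournament r').

(** Symmetrising the inversion indicator separates it into a term for [r] and a term for [r']; this
    is what lets white and black vertices be treated independently. *)
Lemma inversionC e f :
  ((r e f && r' f e)%:R + (r f e && r' e f)%:R : 'F_2) =
  (r e f)%:R + (r' e f)%:R.
Proof.
rewrite (tr e f) (tr' e f); case: (eqVneq e f) => [->|_] /=.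
  by rewrite (tournament_irr f tr) (tournament_irr f tr').
by case: (r e f); case: (r' e f); rewrite /= ?F2_addxx ?addr0 ?add0r.
Qed.

Lemma quadD x y : quad (fun e => x e + y e) = quad x + quad y + polar x y.
Proof.
have -> : polar x y = \sum_e \sum_f x e * y f * (r e f && r' f e)%:R +
                      \sum_e \sum_f y e * x f * (r e f && r' f e)%:R.
  rewrite [X in _ + X]exchange_big -big_split; apply: eq_bigr => e _ /=.
  rewrite -big_split; apply: eq_bigr => f _ /=.
  by rewrite -inversionC mulrDr [y f * _]mulrC.
rewrite -addrA (addrCA (quad y)) addrA [quad y + _]addrC addrA /quad.
rewrite -!big_split; apply: eq_bigr => e _ /=.
rewrite -!big_split; apply: eq_bigr => f _ /=; ring.
Qed.

Fixpoint pair_sum (T : Type) (g : T -> T -> 'F_2) (s : seq T) : 'F_2 :=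
  if s is a :: s' then \sum_(b <- s') g a b + pair_sum g s' else 0.

(** A single edge has [quad] zero, so adding the elements of [s] one by one brings in polar terms
    only. Repetitions in [s] are allowed, as they occur when a face runs along both sides of an
    edge. *)
Lemma quad_count (s : seq E) :
  quad (fun e => (count_mem e s)%:R) =
  pair_sum (fun e f => (r e f)%:R + (r' e f)%:R) s.
Proof.
elim: s => [|a s IHs] /=.
  by rewrite /quad big1 // => e _; rewrite big1 // => f _; rewrite mul0r mul0r.
rewrite -IHs -[LHS](@eq_quad (fun e => (a == e)%:R + (count_mem e s)%:R));
  last first.
  by move=> e; rewrite natrD.
rewrite quadD [quad (fun e => (a == e)%:R)]big1 ?add0r; last first.
  move=> e _; rewrite big1 // => f _; case: eqVneq => [<-|]; last by rewrite !mul0r.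
  by case: eqVneq => [<-|]; rewrite ?mulr0 ?mul0r // tournament_irr // mulr0.
rewrite addrC; congr (_ + _); rewrite /polar (bigD1 a) //= [X in _ + X]big1;
  last first.
  by move=> e /negPf; rewrite eq_sym => ->; rewrite big1 // => f _; rewrite !mul0r.
rewrite addr0 eqxx; elim: s {IHs} => [|b s IHs] /=.
  by rewrite big_nil big1 // => f _; rewrite mulr0 mul0r.
rewrite big_cons -IHs.
have -> : (r a b)%:R + (r' a b)%:R =
          \sum_f (b == f)%:R * ((r a f)%:R + (r' a f)%:R) :> 'F_2.
  rewrite (bigD1 b) //= eqxx mul1r big1 ?addr0 // => f /negPf.
  by rewrite eq_sym => ->; rewrite mul0r.
rewrite -big_split; apply: eq_bigr => f _ /=.
by rewrite natrD !mul1r mulrDl.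
Qed.

End QuadraticForm.

Lemma eq_pair_sum (T : Type) (g g' : T -> T -> 'F_2) (s : seq T) :
  (forall a b, g a b = g' a b) -> pair_sum g s = pair_sum g' s.
Proof.
move=> eg; elim: s => //= a s ->; congr (_ + _).
by apply: eq_bigr => b _; apply: eg.
Qed.

Lemma pair_sumD (T : Type) (g g' : T -> T -> 'F_2) (s : seq T) :
  pair_sum (fun a b => g a b + g' a b) s = pair_sum g s + pair_sum g' s.
Proof.
by elim: s => [|a s IHs] /=; rewrite ?addr0 // IHs big_split addrACA.
Qed.

Lemma pair_sum_map (S T : Type) (h : S -> T) (g : T -> T -> 'F_2) (s : seq S) :
  pair_sum g (map h s) = pair_sum (fun a b => g (h a) (h b)) s.
Proof. by elim: s => //= a s ->; rewrite big_map. Qed.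

Lemma pair_sum_rcons (T : Type) (g : T -> T -> 'F_2) (s : seq T) (a : T) :
  pair_sum g (rcons s a) = pair_sum g s + \sum_(b <- s) g b a.
Proof.
elim: s => [|b s IHs] /=; first by rewrite !big_nil addr0.
by rewrite IHs -cats1 big_cat !big_cons !big_nil /= addr0 addrACA.
Qed.

(** Terms between distinct blocks cancel in fours, leaving the pair inside each block. The blocks
    will be the corners of a face. *)
Lemma pair_sum_blocks (T : eqType) (f : T -> T) (g : T -> T -> 'F_2) (s : seq T) :
    uniq s ->
    {in s &, forall a b, a != b ->
       g a b + g a (f b) + g (f a) b + g (f a) (f b) = 0} ->
  pair_sum g (flatten [seq [:: a; f a] | a <- s]) = \sum_(a <- s) g a (f a).
Proof.
elim: s => [|a s IHs] /=; first by rewrite big_nil.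
move=> /andP[as' us] g0; rewrite !big_cons -!addrA; congr (_ + _).
rewrite IHs // => [|b c bs cs]; last first.
  by apply: g0; rewrite inE ?bs ?cs orbT.
rewrite addrA -big_split (_ : \big[_/_]_(i <- _) _ = 0) ?add0r //.
have: {in s, forall b, g a b + g a (f b) + g (f a) b + g (f a) (f b) = 0}.
  move=> b bs; apply: g0; rewrite ?inE ?eqxx ?bs ?orbT //.
  by apply: contraNneq as' => ->.
elim: s {IHs us as' g0} => [|b s IHs] g0; first by rewrite big_nil.
rewrite /= !big_cons IHs => [|c cs]; last by apply: g0; rewrite inE cs orbT.
rewrite addr0 -[RHS](g0 b (mem_head _ _)); ring.
Qed.

(** * Corners and faces *)

Section Rotation.
Variables (N : nat) (E : finType) (v : E -> 'I_N) (L : 'I_N -> seq E).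
Hypotheses (uniqL : forall x, uniq (L x))
           (memL : forall x e, (e \in L x) = (v e == x)).

Definition pos (e : E) : nat := index e (L (v e)).
Definition nxt (e : E) : E := next (L (v e)) e.
Definition before : rel E := lexr (fun e => v e : nat) (fun e f =>
  (pos e < pos f)%N).

(* Darts are compared through their edges; on a common edge [(e, false)] comes
   first.  With this choice the two darts bounding a corner are in order unless
   the cilium points into the corner. *)
Definition dart_before : rel (E * bool) :=
  lexr (fun d => v d.1 : nat) (lexr (fun d => pos d.1) (fun d d' =>
    ~~ d.2 && d'.2)).

Lemma memLv e : e \in L (v e).
Proof. by rewrite memL. Qed.

Lemma pos_inj e f : v e = v f -> pos e = pos f -> e = f.
Proof.
move=> vef; rewrite /pos -vef => /(congr1 (nth e (L (v e)))).
by rewrite !nth_index ?memL ?vef.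
Qed.

Lemma before_tournament : tournament before.
Proof.
move=> e f; apply: lexr_asym => /ord_inj vef.
by apply: ltn_asym; apply: pos_inj.
Qed.

Lemma dart_before_tournament : tournament dart_before.
Proof.
move=> [e a] [f b]; apply: lexr_asym => /ord_inj /= vef.
apply: lexr_asym => /= /(pos_inj vef) ->.
by rewrite xpair_eqE eqxx; case: a; case: b.
Qed.

(** Vertex and position together determine the edge, so [r] only breaks ties between objects lying
    on one edge. *)
Lemma lexr_beforeE (T : eqType) (g : T -> E) (r : rel T) (x y : T) :
  lexr (fun z => v (g z) : nat) (lexr (fun z => pos (g z)) r) x y =
  before (g x) (g y) || (g x == g y) && r x y.
Proof.
rewrite /before /lexr; case: (ltngtP (v (g x)) (v (g y))) => //= [|/ord_inj] vxy.
  by case: eqVneq => // xy; rewrite xy ltnn in vxy.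
case: (ltngtP (pos (g x)) (pos (g y))) => //= [|/(pos_inj vxy) ->];
  last by rewrite eqxx.
by case: eqVneq => // ->; rewrite ltnn.
Qed.

Lemma dart_beforeE (d d' : E * bool) :
  dart_before d d' = before d.1 d'.1 || [&& d.1 == d'.1, ~~ d.2 & d'.2].
Proof. exact: lexr_beforeE. Qed.

Lemma pos_lt e : (pos e < size (L (v e)))%N.
Proof. by rewrite index_mem memLv. Qed.

Lemma v_nxt e : v (nxt e) = v e.
Proof. by apply/eqP; rewrite -memL mem_next memLv. Qed.

Lemma pos_nxt e : pos (nxt e) =
  if (pos e).+1 == size (L (v e)) then 0%N else (pos e).+1.
Proof. by rewrite /pos v_nxt index_next ?memLv. Qed.

Lemma nxt_inj : injective nxt.
Proof.
move=> e f ef; have vef : v e = v f by rewrite -v_nxt ef v_nxt.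
apply: (can_inj (prev_next (uniqL (v e)))).
by move: ef; rewrite /nxt -vef.
Qed.

Lemma corner_before e :
  dart_before (e, true) (nxt e, false) = (pos (nxt e) != 0%N).
Proof.
rewrite /dart_before /lexr /= v_nxt pos_nxt eqxx ltnn /=.
by case: ifP => _; rewrite ?ltn0 ?andbF ?ltnSn.
Qed.

Lemma corner_after e :
  dart_before (nxt e, false) (e, true) = (pos (nxt e) == 0%N).
Proof.
by rewrite dart_before_tournament corner_before negbK xpair_eqE /= andbF.
Qed.

(** At a common vertex the two darts of a corner are neighbours in [dart_before], so any other dart
    compares alike with both. The exception is the corner holding the cilium: its darts are the last
    and the first one, and both darts of the other corner lie between them. Either way the four bits
    cancel. *)
Lemma corners_before e f (b := fun d d' => (dart_before d d')%:R : 'F_2) : e != f ->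
  b (e, true) (f, true) + b (e, true) (nxt f, false)
  + b (nxt e, false) (f, true) + b (nxt e, false) (nxt f, false) = 0.
Proof.
move=> nef; rewrite /b -!F2_addb /dart_before /lexr /= !v_nxt.
case: (ltngtP (v e) (v f)) => [_|_|/ord_inj vef] //.
have nposef : pos e != pos f by apply: contraNneq nef => /(pos_inj vef) ->.
rewrite !pos_nxt -vef !andbT !andbF !orbF.
have := pos_lt f; have := pos_lt e; rewrite -vef.
move: (pos e) (pos f) (size _) nposef => i j k /eqP nij lti ltj.
rewrite (_ : addb _ _ = false) //.
by case: eqP => ei; case: eqP => ej; lia.
Qed.

Lemma rotation_orbit e f : v e = v f -> fconnect nxt e f.
Proof.
move=> vef; have fL : f \in L (v e) by rewrite vef memLv.
have : fconnect (next (L (v e))) e f.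
  by rewrite (fconnect_cycle (cycle_next (uniqL _))) ?memLv.
move=> /connectP[p pth ->]; apply/connectP; exists p => //.
have [w vew] : exists w, v e = w by exists (v e).
rewrite vew in pth; clear f vef fL;
  elim: p e vew pth => //= a p IHp e vew /andP[/eqP <- pth].
have nxtE : next (L w) e = nxt e by rewrite /nxt vew.
by rewrite nxtE eqxx IHp ?v_nxt // -nxtE.
Qed.

Section Weights.
Variables (x : E -> 'F_2) (t : 'F_2).
Hypothesis sum_x : forall w, \sum_(e | v e == w) x e = t.

Definition weight_after e : 'F_2 := \sum_f x f * (before e f)%:R.

(** Moving on to the next half-edge removes its weight from what lies after; passing the cilium
    brings back the total weight [t] of the vertex. *)
Lemma weight_after_nxt e :
  weight_after e + weight_after (nxt e) = x (nxt e) + (pos (nxt e) == 0%N)%:R * t.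
Proof.
have afterE g : weight_after g = \sum_(f | (v g < v f)%N) x f +
    \sum_(f | (v f == v g) && (pos g < pos f)%N) x f.
  rewrite /weight_after (bigID (fun f => v g < v f)%N) /=; congr (_ + _).
    by apply: eq_bigr => f gf; rewrite /before /lexr gf mulr1.
  rewrite [RHS]big_mkcond [LHS]big_mkcond; apply: eq_bigr => f _.
  rewrite /before /lexr eq_sym -val_eqE /=; case: (ltngtP (v g) (v f)) => //=.
    by rewrite mulr0.
  by case: ltnP; rewrite ?mulr1 ?mulr0.
rewrite !afterE v_nxt addrACA F2_addxx add0r pos_nxt.
case: eqP => [lst|/eqP/negPf nlst].
  rewrite [X in X + _]big1 ?add0r => [|f /andP[/eqP vf]]; last first.
    by have := pos_lt f; rewrite vf; lia.
  have nxt0 : pos (nxt e) = 0%N by rewrite pos_nxt lst eqxx.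
  rewrite eqxx mul1r -(sum_x (v e)) [X in _ = _ + X](bigD1 (nxt e)) /=;
    last by rewrite v_nxt.
  rewrite addrA F2_addxx add0r; apply: eq_bigl => f.
  case: (eqVneq (v f) (v e)) => //= vf; rewrite lt0n -nxt0.
  by congr (~~ _); apply/eqP/eqP => [/pos_inj->|->] //; rewrite v_nxt.
have nxtS : pos (nxt e) = (pos e).+1 by rewrite pos_nxt nlst.
rewrite /= mul0r addr0 [X in X + _](bigD1 (nxt e)) /=; last first.
  by rewrite v_nxt nxtS eqxx ltnSn.
set y := (X in _ + X); rewrite -addrA -[RHS]addr0; congr (_ + _).
rewrite -[RHS](F2_addxx y); congr (_ + _); apply: eq_bigl => f;
  case: (eqVneq (v f) (v e)) => //= vf.
rewrite -nxtS [in RHS]ltn_neqAle nxtS andbC -nxtS eq_sym; congr (~~ _ && _).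
by apply/eqP/eqP => [->|/pos_inj->] //; rewrite v_nxt.
Qed.

End Weights.
End Rotation.
Lemma traject_double (T : Type) (f : T -> T) (x : T) (p : nat) :
  traject f x p.*2 = flatten [seq [:: a; f a] | a <- traject (f \o f) x p].
Proof. by elim: p x => //= p IHp x; rewrite IHp. Qed.

Lemma uniq_blocks (T : eqType) (f : T -> T) (s : seq T) :
  uniq (flatten [seq [:: a; f a] | a <- s]) -> uniq s.
Proof.
elim: s => //= a s IHs /and3P[]; rewrite inE negb_or => /andP[_ as'] _ /IHs ->.
rewrite andbT; apply: contra as' => as'.
by apply/flattenP; exists [:: a; f a]; rewrite ?mem_head //; apply: map_f.
Qed.

(** * Boundaries of faces and the quadratic form *)

Section Faces.
Variables (N : nat) (G : cgraph N).
Hypothesis cG : ciliated G.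

Local Notation fn := (@face_next N G).
Local Notation nxtW := (nxt (@wh N G) (@word N G)).
Local Notation nxtB := (nxt (@bl N G) (@bord N G)).
Local Notation posW := (pos (@wh N G) (@word N G)).
Local Notation posB := (pos (@bl N G) (@bord N G)).
Definition wbefore := before (@wh N G) (@word N G).
Definition bbefore := before (@bl N G) (@bord N G).
Local Notation wdart := (dart_before (@wh N G) (@word N G)).
Local Notation bdart := (dart_before (@bl N G) (@bord N G)).

Lemma word_uniq w : uniq (word G w).
Proof. by case: (cG.2 w). Qed.

Lemma mem_word w e : (e \in word G w) = (wh e == w).
Proof. by case: (cG.2 w). Qed.

Lemma bord_uniq b : uniq (bord G b).
Proof. by case: (cG.1 b). Qed.

Lemma mem_bord b e : (e \in bord G b) = (bl e == b).
Proof. by case: (cG.1 b). Qed.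

Hint Resolve word_uniq mem_word bord_uniq mem_bord : core.

Lemma wbefore_tournament : tournament wbefore.
Proof. exact: before_tournament. Qed.

Lemma bbefore_tournament : tournament bbefore.
Proof. exact: before_tournament. Qed.

Lemma face_next_white e : fn (e, true) = (nxtW e, false).
Proof. by []. Qed.

Lemma face_next_black e : fn (nxtB e, false) = (e, true).
Proof. by rewrite /face_next /= v_nxt // /nxt prev_next. Qed.

(** Puts a dart leaving a white end into the form to which [face_next_black] applies. *)
Lemma black_dartE (e : edge G) : {f | e = nxtB f}.
Proof.
exists (prev (bord G (bl e)) e); rewrite /nxt.
have -> : bl (prev (bord G (bl e)) e) = bl e.
  by apply/eqP; rewrite -mem_bord mem_prev mem_bord.
by rewrite next_prev.
Qed.

Lemma face_next_flip d : (fn d).2 = ~~ d.2.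
Proof. by case: d => e []. Qed.

Lemma face_next_inj : injective fn.
Proof.
move=> [e a] [f b] ef; have := congr1 snd ef; rewrite !face_next_flip /=.
move=> /negb_inj ab; rewrite -{}ab in ef *; case: a ef.
  by rewrite !face_next_white => -[/nxt_inj->].
have [e' ->] := black_dartE e; have [f' ->] := black_dartE f.
by rewrite !face_next_black => -[->].
Qed.

Lemma cilium_white e : cilium_corner (fn (e, true)) = (posW (nxtW e) == 0%N).
Proof.
rewrite face_next_white /cilium_corner /= /pos; set f := nxtW e.
have : f \in word G (wh f) by rewrite mem_word.
case: (word G (wh f)) => //= g s _; rewrite eq_sym.
by case: eqVneq.
Qed.

Lemma cilium_black e : cilium_corner (e, true) = (posB (nxtB e) == 0%N).
Proof.
rewrite /cilium_corner /= pos_nxt // /pos.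
have : e \in bord G (bl e) by rewrite mem_bord.
move: (bord_uniq (bl e)); move: (bord G (bl e)) => s us es.
have lt_es : (index e s < size s)%N by rewrite index_mem.
have -> : (e == last e s) = ((index e s).+1 == size s).
  rewrite -nth_last -{1}(nth_index e es); apply/eqP/eqP => [|<- //].
  by move=> /(congr1 (fun g => index g s)); rewrite !index_uniq //;
    case: (size s) lt_es => //= k _ -> .
by case: eqP.
Qed.

(** Modulo 2, an edge with the same face on both sides drops out. *)
Definition boundary (F : {set dart G}) (e : edge G) : 'F_2 :=
  ((e, true) \in F)%:R + ((e, false) \in F)%:R.

Lemma sum_boundary (F : {set dart G}) (g : edge G -> 'F_2) :
  \sum_e boundary F e * g e = \sum_(d in F) g d.1.
Proof.
have -> : \sum_(d in F) g d.1 =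
    \sum_(d : edge G * bool) if (d.1, d.2) \in F then g d.1 else 0.
  by rewrite big_mkcond; apply: eq_bigr => -[].
rewrite -(pair_bigA _ (fun e b => if (e, b) \in F then g e else 0)) /=.
apply: eq_bigr => e _; rewrite /boundary mulrDl big_bool /=.
by do 2!case: (_ \in F); rewrite ?mul1r ?mul0r.
Qed.

Lemma face_next_mem F d : F \in faces G -> (fn d \in F) = (d \in F).
Proof.
case/imsetP=> d0 _ ->; rewrite !inE.
by rewrite -(same_fconnect1_r face_next_inj).
Qed.

Lemma sum_face_next F (b : bool) (g : dart G -> 'F_2) : F \in faces G ->
  \sum_(d in F | d.2 == b) g (fn d) = \sum_(d in F | d.2 == ~~ b) g d.
Proof.
move=> FG; rewrite [RHS](reindex_inj face_next_inj); apply: eq_bigl => d.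
by rewrite face_next_mem // face_next_flip (inj_eq negb_inj).
Qed.

Definition cilia (F : {set dart G}) : nat := #|[set d in F | cilium_corner d]|.

(** The white order is read at the white corners and the black order at the black ones, where
    [weight_after_nxt] leaves one edge weight, and [t] for a cilium. Both colours leave the weights
    of the same darts, those starting at white ends, and these cancel. *)
Lemma polar_face F (x : edge G -> 'F_2) (t : 'F_2) : F \in faces G ->
    (forall v : vertex N, \sum_(e | incident e v) x e = t) ->
  polar wbefore bbefore (boundary F) x = (cilia F)%:R * t.
Proof.
move=> FG sum_x.
set wW := weight_after (@wh N G) (@word N G) x.
set wB := weight_after (@bl N G) (@bord N G) x.
have -> : polar wbefore bbefore (boundary F) x =
    \sum_(d in F) wW d.1 + \sum_(d in F) wB d.1.
  rewrite -big_split -(sum_boundary F (fun e => wW e + wB e));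
    apply: eq_bigr => e _.
  rewrite /wW /wB /weight_after -big_split mulr_sumr; apply: eq_bigr => f _ /=;
    ring.
have split1 (g : dart G -> 'F_2) : \sum_(d in F) g d =
    \sum_(d in F | d.2 == true) g d + \sum_(d in F | d.2 == false) g d.
  by rewrite (bigID (fun d : dart G => d.2)) /=; congr (_ + _);
    apply: eq_bigl => d; case: d.2; rewrite ?andbT ?andbF.
have {}split (g g' : dart G -> 'F_2) : \sum_(d in F) g d + \sum_(d in F) g' d =
    \sum_(d in F | d.2 == true) (g d + g (fn d)) +
    \sum_(d in F | d.2 == false) (g' d + g' (fn d)).
  by rewrite !big_split /= !sum_face_next //= !split1; ring.
rewrite split.
have -> : \sum_(d in F | d.2 == true) (wW d.1 + wW (fn d).1) =
    \sum_(d in F | d.2 == true) (x (fn d).1 + (cilium_corner (fn d))%:R * t).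
  apply: eq_bigr => -[e b] /andP[_ /eqP /= ->]; rewrite cilium_white.
  by apply: weight_after_nxt => // w; apply: (sum_x (inr w)).
have -> : \sum_(d in F | d.2 == false) (wB d.1 + wB (fn d).1) =
    \sum_(d in F | d.2 == false) (x d.1 + (cilium_corner (fn d))%:R * t).
  apply: eq_bigr => -[e b] /andP[_ /eqP /= ->].
  have [e' ->] := black_dartE e; rewrite face_next_black cilium_black /= addrC.
  by apply: weight_after_nxt => // w; apply: (sum_x (inl w)).
rewrite (sum_face_next true (fun d => x d.1 + (cilium_corner d)%:R * t)) //=.
rewrite !big_split /= (sum_face_next false (fun d => (cilium_corner d)%:R * t)) //=.
rewrite addrCA !addrA F2_addxx add0r addrC -split1 -mulr_suml; congr (_ * t).
by rewrite /cilia -sum1_card natr_sum big_mkcond [RHS]big_mkcond;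
  apply: eq_bigr => d _; rewrite inE; case: (d \in F); case: cilium_corner.
Qed.

(* Along the face the darts come in pairs meeting at white corners; after the
   first dart has been moved to the end they come in pairs meeting at black
   corners.  The move costs [#|F| - 1] inversions, an odd number; otherwise only
   the two darts of a pair matter. *)
Lemma quad_face F : F \in faces G ->
  quad wbefore bbefore (boundary F) = (#|F|./2)%:R + 1 + (cilia F)%:R.
Proof.
move=> FG.
(* Starting at a black end makes the white corners the consecutive pairs of the orbit. *)
have [d0 d0T FE] : exists2 d0 : dart G, d0.2 & F = face_of d0.
  case/imsetP: FG => d _ ->; case dT: d.2; first by exists d.
  exists (fn d); first by rewrite face_next_flip dT.
  by apply/setP=> d'; rewrite !inE (same_fconnect1 face_next_inj).
set l := fingraph.order fn d0; set p := l./2.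
have flip k d : (iter k fn d).2 = odd k (+) d.2.
  by elim: k => //= k IHk; rewrite face_next_flip IHk addNb.
(* Directions alternate along the face, so its length is even. *)
have lE : l = p.*2.
  rewrite /p -[LHS]odd_double_half; have := flip l d0; rewrite iter_order;
    last exact: face_next_inj.
  by rewrite d0T; case: (odd l).
pose S := fingraph.orbit fn d0.
have memS d : (d \in F) = (d \in S) by rewrite FE inE fconnect_orbit.
have uS : uniq S := orbit_uniq fn d0.
have SE : S = flatten [seq [:: a; fn a] | a <- traject (fn \o fn) d0 p].
  by rewrite -traject_double -lE.
have S'E : rcons (behead S) d0 = flatten [seq [:: a;
  fn a] | a <- traject (fn \o fn) (fn d0) p].
  rewrite -traject_double -lE /S /fingraph.orbit -/l.
  have := iter_order face_next_inj d0; rewrite -/l.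
  have: (0 < l)%N by rewrite fingraph.order_gt0.
  by case: (l) => // l' _ l'd0; rewrite [RHS]trajectSr -iterSr l'd0.
have ts'E : traject (fn \o fn) (fn d0) p = map fn (traject (fn \o fn) d0 p).
  by elim: (p) (d0) => //= k IHk d; rewrite -IHk.
have SE1 : d0 :: behead S = S by rewrite /S /fingraph.orbit -fingraph.orderSpred.
have S'fn : rcons (behead S) d0 = map fn S.
  rewrite S'E SE ts'E; elim: (traject _ _ _) => //= a s ->.
  by [].
have uts : uniq (traject (fn \o fn) d0 p) by apply: (@uniq_blocks _ fn);
  rewrite -SE.
have tsT : {in traject (fn \o fn) d0 p, forall a, a = (a.1, true)}.
  move=> a /trajectP[k _ ->].
  have -> : iter k (fn \o fn) d0 = iter k.*2 fn d0 by elim: k => //= k ->.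
  by rewrite [LHS]surjective_pairing flip odd_double d0T.
have ciliaE : (cilia F)%:R = \sum_(a <- S) (cilium_corner (fn a))%:R :> 'F_2.
  rewrite /cilia -sum1_card natr_sum -(big_map fn xpredT (fun a =>
    (cilium_corner a)%:R)) -S'fn.
  have pS : perm_eq (rcons (behead S) d0) S by rewrite -{2}SE1 perm_rcons.
  rewrite (perm_big _ pS) /=.
  rewrite big_uniq //= big_mkcond [RHS]big_mkcond; apply: eq_bigr => a _.
  by rewrite inE memS; case: (a \in S); case: cilium_corner.
have -> : (#|F|./2)%:R = \sum_(a <- traject (fn \o fn) d0 p) 1 :> 'F_2.
  rewrite big_const_seq count_predT size_traject iter_addr_0; congr (_%:R).
  rewrite (eq_card memS) (card_uniqP uS) size_orbit.
  by rewrite -/l lE doubleK.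
have -> : quad wbefore bbefore (boundary F) = pair_sum (fun a b => (wdart a b)%:R) S
    + pair_sum (fun a b => (bdart a b)%:R) S.
  rewrite -pair_sumD.
  have := quad_count wbefore_tournament bbefore_tournament (map fst S).
  rewrite pair_sum_map => qS.
  rewrite (@eq_quad _ _ _ _ (fun e => (count_mem e (map fst S))%:R)).
    (* Ties between darts of one edge are broken in the same way by [wdart] and [bdart], hence
       cancel. *)
    rewrite qS; apply: eq_pair_sum => a b; rewrite !dart_beforeE //.
    rewrite -/wbefore -/bbefore; case: eqP => [->|_]; last by rewrite !orbF.
    rewrite !(tournament_irr _ wbefore_tournament) !(tournament_irr _
      bbefore_tournament).
    by rewrite /= !F2_addxx.
  move=> e; rewrite count_map -sum1_count natr_sum big_mkcond big_uniq //=.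
  have -> : boundary F e = \sum_f boundary F f * (f == e)%:R.
    rewrite (bigD1 e) //= eqxx mulr1 big1 ?addr0 // => f /negPf ->.
    by rewrite mulr0.
  rewrite (sum_boundary F (fun f => (f == e)%:R)) big_mkcond [RHS]big_mkcond.
  apply: eq_bigr => a _; rewrite memS.
  by case: (a \in S) => //=; case: (a.1 == e).
have -> : pair_sum (fun a b => (wdart a b)%:R) S =
    \sum_(a <- traject (fn \o fn) d0 p) (1 + (cilium_corner (fn a))%:R).
  rewrite SE pair_sum_blocks //.
    rewrite big_seq [RHS]big_seq; apply: eq_bigr => a /tsT ->.
    rewrite cilium_white face_next_white corner_before //.
    by case: (_ == _); rewrite ?addr0 ?F2_addxx.
  move=> a b /tsT -> /tsT -> nab; rewrite !face_next_white;
    apply: corners_before => //.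
  by apply: contraNneq nab => ->.
have -> : pair_sum (fun a b => (bdart a b)%:R) S = 1 +
    \sum_(a <- traject (fn \o fn) d0 p) (cilium_corner (fn (fn a)))%:R.
  have -> : pair_sum (fun a b => (bdart a b)%:R) S =
      1 + pair_sum (fun a b => (bdart a b)%:R) (rcons (behead S) d0).
    rewrite -{1}SE1 pair_sum_rcons [RHS]addrC addrAC -addrA [RHS]addrC [X in _
      = X + _]addrC /=.
    congr (_ + _).
    have d0S : d0 \notin behead S by move: uS; rewrite -{1}SE1 => /andP[].
    have size1 : \sum_(b <- behead S) 1 = 1 :> 'F_2.
      rewrite big_const_seq count_predT size_behead size_orbit -/l lE iter_addr_0.
      have : (0 < p.*2)%N by rewrite -lE fingraph.order_gt0.
      by case: (p) => // k _; rewrite F2_natr doubleS /= odd_double.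
    rewrite -[X in _ = _ + X]size1 -big_split big_seq [RHS]big_seq.
    apply: eq_bigr => b bS /=.
    rewrite (dart_before_tournament mem_bord d0 b).
    have -> /= : d0 != b by apply: contraNneq d0S => ->.
    by case: (bdart d0 b); rewrite ?add0r ?F2_addxx.
  congr (1 + _); rewrite S'E pair_sum_blocks; last 1 first.
  - move=> a b; rewrite ts'E => /mapP[a' /tsT -> ->] /mapP[b' /tsT -> ->].
    rewrite !face_next_white.
    have [e ->] := black_dartE (nxtW a'.1); have [f ->] := black_dartE (nxtW b'.1).
    rewrite !face_next_black => nab;
      have nef : e != f by apply: contraNneq nab => ->.
    rewrite -[RHS](corners_before bord_uniq mem_bord nef); ring.
  - rewrite ts'E big_map big_seq [RHS]big_seq; apply: eq_bigr => a /tsT ->.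
    rewrite face_next_white; have [e ->] := black_dartE (nxtW a.1).
    by rewrite face_next_black cilium_black corner_after.
  - by apply: (@uniq_blocks _ fn); rewrite -S'E rcons_uniq -cons_uniq SE1.
rewrite ciliaE SE.
have blocks (g : dart G -> 'F_2) s : \sum_(a <- flatten [seq [:: a;
  fn a] | a <- s]) g a =
    \sum_(a <- s) (g a + g (fn a)).
  by elim: s => [|a s IHs]; rewrite ?big_nil //= !big_cons IHs addrA.
rewrite blocks !big_split /=; ring.
Qed.
End Faces.
(** * Kasteleyn signs and the cycle space *)

Definition sign_bit (z : int) : 'F_2 := (z == -1)%:R.

Lemma sign_bitX (k : nat) : sign_bit ((-1) ^+ k) = k%:R.
Proof. by rewrite -signr_odd F2_natr; case: (odd k). Qed.

Lemma sign_bit_prod (I : Type) (s : seq I) (P : pred I) (F : I -> int) :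
    (forall i, F i = 1 \/ F i = -1) ->
  sign_bit (\prod_(i <- s | P i) F i) = \sum_(i <- s | P i) sign_bit (F i).
Proof.
move=> F1; have FE i : F i = (-1) ^+ (F i == -1) by case: (F1 i) => ->.
rewrite (eq_bigr _ (fun i _ => FE i)) prodrXr sign_bitX natr_sum.
by apply: eq_bigr => i _; rewrite /sign_bit.
Qed.

Lemma sign_bit_exprz (z : int) : sign_bit ((-1) ^ z) = (`|z|%N)%:R.
Proof.
case: z => k; first exact: sign_bitX.
by rewrite [in LHS]NegzE -exprz_inv invrN1; apply: sign_bitX.
Qed.

Section Kasteleyn.
Variables (n N : nat) (G : cgraph N) (outer : {set {set dart G}}).
Variable eps : edge G -> int.
Hypotheses (cG : ciliated G) (kG : kasteleyn n outer eps).

(* Depends on multiplicities modulo 2 only, hence makes sense for the sums of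
   boundaries of faces which lead from one multiweb to another. *)
Definition web_sign (x : edge G -> 'F_2) : 'F_2 :=
  quad (@wbefore N G) (@bbefore N G) x + \sum_e x e * sign_bit (eps e).

Lemma boundary_closed (F : {set dart G}) (v : vertex N) : F \in faces G ->
  \sum_(e | incident e v) boundary F e = 0.
Proof.
move=> FG; have -> : \sum_(e | incident e v) boundary F e =
    \sum_e boundary F e * (incident e v)%:R.
  by rewrite big_mkcond; apply: eq_bigr => e _; case: incident;
    rewrite ?mulr1 ?mulr0.
rewrite (sum_boundary F (fun e => (incident e v)%:R)).
(* The darts singled out here point towards the colour of [v]. Each is followed by a dart starting
   where it ends, so incidences with [v] come in equal pairs. *)
rewrite (bigID (fun d : dart G => d.2 == (if v is inr _ then true else false))) /=.
have -> : \sum_(d in F | d.2 != (if v is inr _ then true else false))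
    (incident d.1 v)%:R =
    \sum_(d in F | d.2 == ~~ (if v is inr _ then true else false))
    (incident d.1 v)%:R :> 'F_2.
  by apply: eq_bigl => -[e b] /=; case: b; case: v.
rewrite -(sum_face_next cG _ (fun d => (incident d.1 v)%:R)) // -big_split big1 //.
move=> [e b] /= /andP[_ /eqP ->]; case: v => v /=.
  have /eqP -> : bl (prev (bord G (bl e)) e) == bl e.
    by rewrite -(mem_bord cG) mem_prev (mem_bord cG).
  by rewrite F2_addxx.
have /eqP -> : wh (next (word G (wh e)) e) == wh e.
  by rewrite -(mem_word cG) mem_next (mem_word cG).
by rewrite F2_addxx.
Qed.

Lemma kasteleyn_face F : F \in faces G :\: outer ->
  \sum_(d in F) sign_bit (eps d.1) =
    (#|F|./2)%:R + 1 + (~~ odd n)%:R * (cilia F)%:R.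
Proof.
move=> /(kG.2 F) /(congr1 sign_bit); rewrite sign_bit_prod => [->|d];
  last exact: kG.1.
(* The integer exponents in [kasteleyn] may be negative; their parity is read off absolute
   values. *)
have par (a b : int) : (`|a - b|%N%:R : 'F_2) = `|a|%N%:R + `|b|%N%:R.
  by rewrite -natrD F2_natr [RHS]F2_natr; congr (_%:R); congr nat_of_bool; lia.
case: ifP => _ /=; rewrite sign_bit_exprz !par /=; first by rewrite mul0r addr0.
by rewrite mul1r.
Qed.

Lemma web_sign_face F (x : edge G -> 'F_2) : F \in faces G :\: outer ->
    (forall v : vertex N, \sum_(e | incident e v) x e = n%:R) ->
  web_sign (fun e => boundary F e + x e) = web_sign x.
Proof.
move=> FB sum_x; have FG : F \in faces G by case/setDP: FB.
rewrite /web_sign (quadD (wbefore_tournament cG) (bbefore_tournament cG)).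
rewrite (polar_face cG FG sum_x) (quad_face cG FG).
have -> : \sum_e (boundary F e + x e) * sign_bit (eps e) =
    (#|F|./2)%:R + 1 + (~~ odd n)%:R * (cilia F)%:R + \sum_e x e * sign_bit (eps e).
  rewrite -kasteleyn_face // -(sum_boundary F (fun e =>
    sign_bit (eps e))) -big_split.
  by apply: eq_bigr => e _; rewrite mulrDl.
set a := (_./2)%:R; set c := (cilia F)%:R; set Q := quad _ _ _; set l := \sum_e _.
have -> : a + 1 + c + Q + c * n%:R + (a + 1 + (~~ odd n)%:R * c + l) =
  (a + a) + (1 + 1) + (1 + n%:R + (~~ odd n)%:R) * c + (Q + l) by ring.
rewrite !F2_addxx !add0r (F2_natr n).
by case: (odd n); rewrite /= ?addr0 ?F2_addxx mul0r add0r.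
Qed.

Lemma web_sign_boundaries (I : Type) (s : seq I) (a : I -> 'F_2)
    (F : I -> {set dart G}) (x : edge G -> 'F_2) :
    (forall i, F i \in faces G :\: outer) ->
    (forall v : vertex N, \sum_(e | incident e v) x e = n%:R) ->
  web_sign (fun e => \sum_(i <- s) a i * boundary (F i) e + x e) = web_sign x.
Proof.
move=> FB sum_x; elim: s => [|i s IHs].
  rewrite /web_sign; congr (_ + _); last by apply: eq_bigr => e _;
    rewrite big_nil add0r.
  by apply: eq_quad => e; rewrite big_nil add0r.
have eq_sign y z : y =1 z -> web_sign y = web_sign z.
  by move=> yz; rewrite /web_sign (eq_quad _ _ yz); congr (_ + _);
    apply: eq_bigr => e _; rewrite yz.
have [ai|ai] : a i = 0 \/ a i = 1.
  by case: (a i) => -[|[|//]] k; [left | right]; apply: val_inj.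
  by rewrite -[RHS]IHs; apply: eq_sign => e; rewrite big_cons ai mul0r add0r.
rewrite -[RHS]IHs -[RHS](web_sign_face (FB i)).
  by apply: eq_sign => e; rewrite big_cons ai mul1r addrA.
(* Boundaries are closed, so the partial sums keep the vertex sums [n] modulo 2 and [web_sign_face]
   applies at every stage. *)
move=> v; rewrite big_split /= sum_x exchange_big big1 ?add0r // => j _.
rewrite -mulr_sumr boundary_closed ?mulr0 //.
by have /setDP[] := FB j.
Qed.

End Kasteleyn.

(** * The cycle space modulo 2 and the bounded faces *)

Section CycleSpace.
Variables (N : nat) (G : cgraph N) (outer : {set {set dart G}}).
Hypotheses (cG : ciliated G) (pG : plane outer).

Local Notation bounded := (faces G :\: outer).
Local Notation adjG := (@adj N G).

Lemma adj_connect_sym : connect_sym adjG.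
Proof.
apply: sym_connect_sym => u v; rewrite /adj /= eq_sym; congr (_ && _).
by apply/existsP/existsP => -[e]; rewrite andbC; exists e.
Qed.

Lemma mem_face_of (d : dart G) : d \in face_of d.
Proof. by rewrite inE connect0. Qed.

Lemma face_of_eq (d d' : dart G) : d' \in face_of d -> face_of d' = face_of d.
Proof.
rewrite inE => dd'; apply/setP=> d''; rewrite !inE.
by rewrite (same_connect (fconnect_sym (face_next_inj cG)) dd').
Qed.

Lemma face_of_faces (d : dart G) : face_of d \in faces G.
Proof. by apply/imsetP; exists d. Qed.

Lemma faces_face_of F (d : dart G) : F \in faces G -> d \in F -> F = face_of d.
Proof. by case/imsetP=> d0 _ -> /face_of_eq. Qed.

Lemma face_of_next (d : dart G) : face_of (face_next d) = face_of d.
Proof. by apply: face_of_eq; rewrite inE fconnect1. Qed.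

Lemma outer_sub F : F \in outer -> F \in faces G.
Proof. by case: pG => _ /subsetP/(_ F). Qed.

Lemma outer_dart v : exists2 d : dart G, face_of d \in outer & connect adjG v
  (origin d).
Proof.
case: pG => _ _ /(_ v) c1.
have [F] : exists F, F \in [set F in outer | [exists d in F, connect adjG v
  (origin d)]].
  by apply/card_gt0P; rewrite c1.
rewrite inE => /andP[Fo /existsP[d /andP[dF vd]]]; exists d => //.
by rewrite -(faces_face_of (outer_sub Fo) dF).
Qed.

Lemma outer_inj (d d' : dart G) : face_of d \in outer -> face_of d' \in outer ->
  connect adjG (origin d) (origin d') -> face_of d = face_of d'.
Proof.
move=> od od' dd'; case: pG => _ _ /(_ (origin d)) /eqP/cards1P[F FE].
have: face_of d \in [set F] by rewrite -FE inE od; apply/existsP; exists d;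
  rewrite mem_face_of connect0.
have: face_of d' \in [set F] by rewrite -FE inE od'; apply/existsP; exists d';
  rewrite mem_face_of.
by rewrite !inE => /eqP-> /eqP->.
Qed.

(** An outer face is sent to the root of the component on which it lies; by [plane] no two outer
    faces share a component. *)
Lemma card_outer : (#|outer| <= n_comp adjG predT)%N.
Proof.
pose h (F : {set dart G}) : option (vertex N) :=
  omap (fun d => fingraph.root adjG (origin d)) [pick d in F].
have hE F : F \in outer ->
  exists2 d, F = face_of d & h F = Some (fingraph.root adjG (origin d)).
  move=> Fo; have FG := outer_sub Fo; rewrite /h; case: pickP => [d dF|F0].
    by exists d => //; apply: faces_face_of.
  by case/imsetP: FG F0 => d _ -> /(_ d); rewrite mem_face_of.
have h_inj : {in outer &, injective h}.
  move=> F F' Fo F'o; have [d Fd ->] := hE F Fo; have [d' Fd' ->] := hE F' F'o.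
  case=> /eqP; rewrite root_connect; last exact: adj_connect_sym.
  by rewrite Fd Fd' => dd'; apply: outer_inj; rewrite -?Fd -?Fd'.
rewrite -(card_in_imset h_inj);
  set R := [set Some v | v in predI (roots adjG) predT].
have -> : n_comp adjG predT = #|R| by rewrite card_imset // => ? ? [].
apply/subset_leq_card/subsetP => _ /imsetP[F Fo ->].
have [d _ ->] := hE F Fo; apply: imset_f.
by rewrite !inE andbT roots_root //; apply: adj_connect_sym.
Qed.

(** The cycle space has dimension [#|edge G| - #|vertex N| + n_comp adjG predT]. This inequality is
    the half of Euler's formula that enters the dimension count of [cycle_boundaries]. *)
Lemma card_bounded : (#|edge G| + n_comp adjG predT <= #|bounded| + #|vertex N|)%N.
Proof.
case: (pG) => euler sub _; have := card_outer.
rewrite cardsD (setIidPr sub); have := subset_leq_card sub.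
move: euler; lia.
Qed.

(* A relation among boundaries is constant across every edge and around every
   vertex, hence on each component, and it vanishes on the outer face. *)
Lemma boundary_independent (a : {set dart G} -> 'F_2) :
    (forall e, \sum_(F in bounded) a F * boundary F e = 0) ->
  forall F, F \in bounded -> a F = 0.
Proof.
move=> a0; pose phi (d : dart G) := if face_of d \in outer then 0 else a
  (face_of d).
have phiE d : \sum_(F in bounded) a F * (d \in F)%:R = phi d.
  rewrite /phi; case: ifPn => od.
    rewrite big1 // => F /setDP[FG Fo]; rewrite (negPf (_ : d \notin F)) ?mulr0 //.
    by apply: contra Fo => /(faces_face_of FG) ->.
  rewrite (bigD1 (face_of d)) /=; last by rewrite inE od face_of_faces.
  rewrite mem_face_of mulr1 big1 ?addr0 // => F /andP[/setDP[FG _] Fd].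
  rewrite (negPf (_ : d \notin F)) ?mulr0 //.
  by apply: contra Fd => /(faces_face_of FG) ->.
have phi_edge e : phi (e, true) = phi (e, false).
  have := a0 e; rewrite /boundary; under eq_bigr do rewrite mulrDr.
  rewrite big_split /= !phiE => /eqP; rewrite addr_eq0 F2_opp.
  by move/eqP.
have phi_next d : phi (face_next d) = phi d by rewrite /phi face_of_next.
have phi_white e : phi (nxt (@wh N G) (@word N G) e, true) = phi (e, true).
  by rewrite phi_edge -face_next_white phi_next.
have phi_black e : phi (nxt (@bl N G) (@bord N G) e, true) = phi (e, true).
  by rewrite phi_edge -phi_next face_next_black.
have orbit_const (f : edge G -> edge G) e e' :
    (forall e, phi (f e, true) = phi (e, true)) -> fconnect f e e' ->
  phi (e, true) = phi (e', true).
  move=> fphi /connectP[p pth ->];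
    elim: p e pth => //= e1 p IHp e /andP[/eqP <- /IHp <-].
  by rewrite fphi.
have phi_inc v e e' : incident e v -> incident e' v ->
  phi (e, true) = phi (e', true).
  case: v => v /= /eqP ev /eqP e'v.
    apply: (orbit_const _ _ _ phi_black); apply: rotation_orbit;
      last by rewrite ev e'v.
      exact: bord_uniq.
    exact: mem_bord.
  apply: (orbit_const _ _ _ phi_white); apply: rotation_orbit;
    last by rewrite ev e'v.
    exact: word_uniq.
  exact: mem_word.
have phi_connect e e' v v' : connect adjG v v' -> incident e v -> incident e' v' ->
    phi (e, true) = phi (e', true).
  move=> /connectP[p pth ->]; elim: p v e pth => /= [|u p IHp] v e;
    first by move=> _; apply: phi_inc.
  case/andP=> /andP[_ /existsP[g /andP[gv gu]]] pth ev e'u.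
  by rewrite (phi_inc v e g) //; apply: (IHp u).
have phi_dart d : phi d = phi (d.1, true) by case: d => e [].
have inc_origin (d : dart G) : incident d.1 (origin d) by case: d => e [];
  rewrite /= eqxx.
have phi0 d : phi d = 0.
  have [d' od' dd'] := outer_dart (origin d).
  rewrite phi_dart (phi_connect _ d'.1 _ _ dd') // -phi_dart.
  by rewrite /phi od'.
move=> F /setDP[FG Fo]; case/imsetP: FG Fo => d _ -> od.
by have := phi0 d; rewrite /phi (negPf od).
Qed.

(** A dimension count: the rows of [D2] are independent and lie in the kernel of the incidence
    matrix [D1], whose dimension is at most the number of these rows by [rank1] and
    [card_bounded]. *)
Lemma cycle_boundaries (z : edge G -> 'F_2) :
    (forall v : vertex N, \sum_(e | incident e v) z e = 0) ->
  exists a : {set dart G} -> 'F_2,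
    forall e, z e = \sum_(F in bounded) a F * boundary F e.
Proof.
move=> z0.
pose D1 : 'M['F_2]_(#|edge G|, #|vertex N|) :=
  \matrix_(i, j) (incident (enum_val i) (enum_val j))%:R.
pose D2 : 'M['F_2]_(#|bounded|, #|edge G|) :=
  \matrix_(i, j) boundary (enum_val i) (enum_val j).
pose K : 'M['F_2]_(n_comp adjG predT, #|vertex N|) :=
  \matrix_(i, j) (fingraph.root adjG (enum_val j) == enum_val i)%:R.
have sum_ord (T : finType) (g : T ->
  'F_2) : \sum_(i < #|T|) g (enum_val i) = \sum_x g x.
  by rewrite [RHS](reindex _ (onW_bij _ (enum_val_bij T))).
have D21 : D2 *m D1 = 0.
  apply/matrixP=> i j; rewrite !mxE.
  under eq_bigr do rewrite !mxE.
  have /setDP[FG _] := enum_valP i.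
  rewrite (sum_ord _ (fun e =>
    boundary (enum_val i) e * (incident e (enum_val j))%:R)).
  rewrite -[RHS](boundary_closed cG (enum_val j) FG) [RHS]big_mkcond /=.
  by apply: eq_bigr => e _; case: incident; rewrite ?mulr1 ?mulr0.
have free2 : row_free D2.
  apply: inj_row_free => u uD2.
  pose a F : 'F_2 := if [pick i | enum_val i == F :> {set dart G}] is Some i
    then u 0 i else 0.
  have aE i : a (enum_val i) = u 0 i.
    rewrite /a; case: pickP => [k /eqP/enum_val_inj-> //|/(_ i)];
      first by rewrite eqxx.
  have a0 F : F \in bounded -> a F = 0.
    apply: boundary_independent => e; rewrite big_enum_val /=.
    have /matrixP/(_ 0 (enum_rank e)) := uD2; rewrite !mxE => uE.
    rewrite -[RHS]uE; apply: eq_bigr => i _; by rewrite !mxE aE enum_rankK.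
  by apply/rowP=> i; rewrite mxE -aE a0 // enum_valP.
(* A vector killed by the transpose of [D1] takes equal values at the two ends of every edge, hence
   is constant on components. It is then a combination of the rows of [K], the indicators of
   components. *)
have rank1 : (#|vertex N| <= \rank D1 + n_comp adjG predT)%N.
  rewrite -mxrank_tr -leq_subLR -mxrank_ker.
  apply: leq_trans (rank_leq_row K); apply: mxrankS; apply/row_subP=> i.
  have : row i (kermx D1^T) *m D1^T = 0 by apply/sub_kermxP; apply: row_sub.
  move: (row i _) => y yD1; apply/submxP.
  have y_edge (e : edge G) : y 0 (enum_rank (inl (bl e) : vertex N)) =
    y 0 (enum_rank (inr (wh e) : vertex N)).
    have /matrixP/(_ 0 (enum_rank e)) := yD1; rewrite !mxE.
    under eq_bigr do rewrite !mxE enum_rankK.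
    pose g (v : vertex N) := y 0 (enum_rank v) * (incident e v)%:R.
    rewrite (eq_bigr (fun j => g (enum_val j))) => [|j _];
      last by rewrite /g enum_valK.
    rewrite sum_ord big_sumType /= (bigD1 (bl e)) //= [X in _ + X](bigD1 (wh
      e)) //=.
    rewrite !big1 => [|w /negPf we|w /negPf we];
      try by rewrite /g /= eq_sym we mulr0.
    by rewrite /g /= !eqxx !addr0 !mulr1 => /eqP; rewrite addr_eq0 F2_opp => /eqP.
  have y_adj u v : adjG u v -> y 0 (enum_rank u) = y 0 (enum_rank v).
    case/andP=> _ /existsP[e].
    by case: u; case: v => v u /= /andP[/eqP <- /eqP <-]; rewrite ?y_edge.
  have y_connect u v : connect adjG u v -> y 0 (enum_rank u) = y 0 (enum_rank v).
    case/connectP=> p pth ->; elim: p u pth => //= w p IHp u /andP[/y_adj -> /IHp].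
    by [].
  exists (\row_k y 0 (enum_rank (enum_val k))); apply/rowP=> j; rewrite mxE.
  pose r := fingraph.root adjG (enum_val j).
  have rR : r \in predI (roots adjG) predT.
    by rewrite !inE andbT roots_root //; apply: adj_connect_sym.
  rewrite (bigD1 (enum_rank_in rR r)) //= !mxE enum_rankK_in // eqxx mulr1.
  rewrite big1 ?addr0 => [|k nk].
    by rewrite -(y_connect (enum_val j)) ?enum_valK ?connect_root.
  rewrite !mxE (negPf (_ : _ != _)) ?mulr0 //; apply: contraNneq nk => rk.
  by apply/eqP/enum_val_inj; rewrite enum_rankK_in.
have D2ker : (D2 :=: kermx D1)%MS.
  apply/eqmxP; rewrite -(mxrank_leqif_eq (introT sub_kermxP D21)).
  rewrite (eqP free2) mxrank_ker eqn_leq -{1}(eqP free2) -mxrank_ker.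
  rewrite mxrankS ?(introT sub_kermxP D21) // mxrank_ker.
  have := card_bounded; move: rank1; lia.
pose zr : 'rV_#|edge G| := \row_i z (enum_val i).
have : (zr <= D2)%MS.
  rewrite D2ker; apply/sub_kermxP/rowP=> j; rewrite !mxE -[RHS](z0 (enum_val j)).
  under eq_bigr do rewrite !mxE.
  rewrite (sum_ord _ (fun e =>
    z e * (incident e (enum_val j))%:R)) [RHS]big_mkcond /=.
  by apply: eq_bigr => e _; case: incident; rewrite ?mulr1 ?mulr0.
case/submxP=> u zu.
exists (fun F => if [pick i | enum_val i == F :> {set dart G}] is Some i then u
  0 i else 0).
move=> e; have := congr1 (fun y : 'rV__ => y 0 (enum_rank e)) zu.
rewrite !mxE enum_rankK => ->; rewrite [RHS]big_enum_val; apply: eq_bigr => i _.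
rewrite !mxE enum_rankK; congr (_ * _).
by case: pickP => [k /eqP/enum_val_inj-> //|/(_ i)]; rewrite eqxx.
Qed.

Lemma web_sign_constant n (eps : edge G -> int) (x y : edge G -> 'F_2) :
    kasteleyn n outer eps ->
    (forall v : vertex N, \sum_(e | incident e v) x e = n%:R) ->
    (forall v : vertex N, \sum_(e | incident e v) y e = n%:R) ->
  web_sign eps x = web_sign eps y.
Proof.
move=> kG sum_x sum_y.
have [|a xyE] := @cycle_boundaries (fun e => x e + y e).
  by move=> v; rewrite big_split /= sum_x sum_y F2_addxx.
pose F (i : 'I_#|bounded|) := enum_val i.
have FB i : F i \in bounded by apply: enum_valP.
rewrite -(web_sign_boundaries cG kG (index_enum _) (a \o F) FB sum_y).
have xE e : x e = \sum_i (a \o F) i * boundary (F i) e + y e.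
  by rewrite -(big_enum_val (fun A =>
    a A * boundary A e)) -xyE -addrA F2_addxx addr0.
rewrite /web_sign (eq_quad _ _ xE); congr (_ + _).
by apply: eq_bigr => e _; rewrite xE.
Qed.

End CycleSpace.

(** * Signs of matchings of the blow-up graph *)

Lemma mkpermE (T : finType) (f : T -> T) : injective f -> mkperm f =1 f.
Proof.
move=> f_inj x; have inj_b : injectiveb (finfun f).
  by apply/injectiveP => y z; rewrite !ffunE; apply: f_inj.
by rewrite /mkperm -pvalE [pval _]val_insubd inj_b ffunE.
Qed.

Lemma inv_countE (n : nat) (s : 'S_n) :
  inv_count s = (\sum_(i < n) \sum_(j < n) ((i < j) && (s j < s i)))%N.
Proof.
rewrite /inv_count -sum1_card big_mkcond pair_bigA /=.
by apply: eq_bigr => -[i j] _; rewrite inE; case: (_ && _).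
Qed.

Lemma perm_of_listE (n : nat) (s : seq 'I_n) : uniq s -> size s = n ->
  forall k : 'I_n, nth k s k = perm_of_list s k.
Proof.
move=> us sz k; rewrite /perm_of_list mkpermE // => i j.
rewrite (set_nth_default i j) ?sz // => /(congr1 (index^~ s)).
by rewrite !index_uniq ?sz // => /val_inj.
Qed.

Lemma index_perm_of_list (n : nat) (s : seq 'I_n) (k : 'I_n) :
  uniq s -> size s = n -> index (perm_of_list s k) s = k.
Proof. by move=> us sz; rewrite -perm_of_listE // index_uniq ?sz. Qed.

(** Read by values instead of positions, an inversion becomes a pair of indices of blow-up vertices,
    which can be compared with orders on the matching. *)
Lemma inv_count_perm_of_list (n : nat) (s : seq 'I_n) :
    uniq s -> size s = n ->
  inv_count (perm_of_list s) =
    (\sum_(x < n) \sum_(y < n) ((index x s < index y s) && (y < x)))%N.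
Proof.
move=> us sz; rewrite inv_countE [RHS](reindex_inj (@perm_inj _ (perm_of_list s))).
apply: eq_bigr => i _; rewrite [RHS](reindex_inj (@perm_inj _ (perm_of_list s))).
by apply: eq_bigr => j _; rewrite !index_perm_of_list.
Qed.

Section FlattenIndex.
Variables (E T : eqType) (F : E -> seq T) (key : T -> E).

Lemma mem_flatten_map (s : seq E) x :
    {in s, forall e y, y \in F e -> key y = e} ->
    x \in F (key x) ->
  (x \in flatten (map F s)) = (key x \in s).
Proof.
move=> keyF Fx; apply/flatten_mapP/idP => [[e es xe]|ks]; last by exists (key x).
by rewrite (keyF e es x xe).
Qed.

Lemma uniq_flatten_map (s : seq E) : uniq s -> {in s, forall e, uniq (F e)} ->
  {in s, forall e y, y \in F e -> key y = e} -> uniq (flatten (map F s)).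
Proof.
elim: s => //= e s IHs /andP[es us] uF keyF.
have ss : {subset s <= e :: s} by move=> f fs; rewrite inE fs orbT.
rewrite cat_uniq uF ?mem_head // IHs // => [|f /ss|f /ss]; [|exact: uF|exact: keyF].
rewrite andbT; apply/hasPn=> x /flatten_mapP[f fs xf].
apply: contra es => xe; rewrite -(keyF e (mem_head _ _) x xe).
by rewrite (keyF f (ss f fs) x xf).
Qed.

Lemma index_flatten_map (s : seq E) x y :
    {in s, forall e z, z \in F e -> key z = e} ->
    key x \in s -> key y \in s -> x \in F (key x) -> y \in F (key y) ->
  (index x (flatten (map F s)) < index y (flatten (map F s)))%N =
    (index (key x) s < index (key y) s)%N
    || ((key x == key y) && (index x (F (key x)) < index y (F (key x)))%N).
Proof.
move=> + + + Fx Fy; elim: s => //= e s IHs keyF; rewrite !inE !index_cat.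
have keyF' z : key z != e -> (z \in F e) = false.
  by move=> ze; apply: contraNF ze => /(keyF e (mem_head _ _)) ->.
rewrite ![e == _]eq_sym.
case: (eqVneq (key x) e) => [kx _|kx /= xs].
  rewrite -{1 2}kx Fx; case: (eqVneq (key y) e) => [ky _|ky /= ys].
    by rewrite -{1 2}ky Fy kx ky eqxx.
  by rewrite keyF' //= -kx ltn_addr // index_mem.
rewrite keyF' //; case: (eqVneq (key y) e) => [ky _|ky /= ys].
  rewrite -{1 2}ky Fy ky (negPf kx) ltn0 /= ltnNge.
  by rewrite ltnW // -ky ltn_addr // index_mem.
rewrite keyF' // ltn_add2l ltnS; apply: IHs => // f fs.
by apply: keyF; rewrite inE fs orbT.
Qed.

End FlattenIndex.

Lemma sorted_enum_ord (n : nat) (A : {pred 'I_n}) :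
  sorted (fun x y : 'I_n => (x < y)%N) (enum A).
Proof.
have tr : transitive (fun x y : 'I_n => (x < y)%N) by move=> y x z;
  apply: ltn_trans.
rewrite /enum_mem; apply: sorted_filter => //.
by rewrite -enumT; have := iota_ltn_sorted 0 n; rewrite -val_enum_ord sorted_map.
Qed.

Lemma index_enum_lt (n : nat) (A : {set 'I_n}) : {in A &, forall x y,
  (index x (enum A) < index y (enum A))%N = (x < y)%N}.
Proof.
have lt x y : x \in A -> y \in A -> (index x (enum A) < index y (enum A))%N ->
  (x < y)%N.
  move=> xA yA; apply: (sorted_ltn_index _ (sorted_enum_ord A));
    rewrite ?mem_enum //.
  by move=> ? ? ?; apply: ltn_trans.
move=> x y xA yA; apply/idP/idP => [|xy]; first exact: lt.
rewrite ltnNge leq_eqVlt; apply/norP; split.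
  apply/eqP => /(congr1 (nth x (enum A))); rewrite !nth_index ?mem_enum //.
  by move=> yx; rewrite yx ltnn in xy.
by apply: contraL xy => /(lt _ _ yA xA); rewrite -leqNgt; apply: ltnW.
Qed.

(** Each block is listed increasingly and has no inversion inside, so only the order of the blocks
    matters. *)
Lemma inv_count_blocks (n : nat) (E : eqType) (s : seq E) (X : E -> {set 'I_n})
    (key : 'I_n -> E) :
    uniq s -> (forall k, key k \in s) ->
    {in s, forall e k, (k \in X e) = (key k == e)} ->
  inv_count (perm_of_list (flatten [seq enum (X e) | e <- s])) =
    (\sum_(k < n) \sum_(l < n) ((index (key k) s < index (key l) s) && (l < k)))%N.
Proof.
move=> us keys XE.
have keyX : {in s, forall e (k : 'I_n), k \in enum (X e) -> key k = e}.
  by move=> e es k; rewrite mem_enum XE // => /eqP.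
have Xkey k : k \in enum (X (key k)) by rewrite mem_enum XE.
have uL : uniq (flatten [seq enum (X e) | e <- s]).
  by apply: (uniq_flatten_map us _ keyX) => e _; apply: enum_uniq.
rewrite inv_count_perm_of_list //; last first.
  rewrite -(card_uniqP uL) -[RHS]card_ord; apply: eq_card => k.
  by rewrite (mem_flatten_map keyX) ?keys.
apply: eq_bigr => k _; apply: eq_bigr => l _.
rewrite (index_flatten_map keyX) //; case: ltnP => //= _.
case: eqVneq => //= kl; rewrite index_enum_lt ?XE ?keys //; last exact/eqP.
by case: (ltngtP k l).
Qed.

Lemma big_pairE (V : Type) (idx : V) (op : Monoid.com_law idx) (I J : finType)
    (F : I * J -> V) :
  \big[op/idx]_x F x = \big[op/idx]_i \big[op/idx]_j F (i, j).
Proof. by rewrite pair_bigA; apply: eq_bigr => -[]. Qed.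

Section Matching.
Variables (n N : nat) (G : cgraph N).
Implicit Types (m : {set tedge n G}) (mu : tvertex n N -> tedge n G).

(** A total version of [mate]; the injective map [tbl \o mu] becomes the permutation [black_end]. *)
Definition matched m mu :=
  [/\ m = [set mu x | x : tvertex n N], cancel mu (@twh n N G)
    & injective (@tbl n N G \o mu)].

Lemma tmatchingP m : reflect (exists mu, matched m mu) (tmatching m).
Proof.
apply: (iffP forallP) => [m1 | [mu [-> muK mu_inj]] x].
  have /fin_all_exists[mu muE] x : exists t, [set t in m | twh t == x] = [set t].
    by have /andP[_ /cards1P[t ->]] := m1 x; exists t.
  have mu_m x : (mu x \in m) && (twh (mu x) == x).
    by have := set11 (mu x); rewrite -muE inE.
  have muK : cancel mu (@twh n N G) by move=> x; have /andP[_ /eqP] := mu_m x.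
  exists mu; split=> // [|x y /= xy].
    apply/setP=> t; apply/idP/imsetP => [tm | [x _ ->]];
      last by have /andP[] := mu_m x.
    by exists (twh t) => //; apply/set1P; rewrite -muE inE tm /=.
  have /andP[/cards1P[t tE] _] := m1 (tbl (mu x)).
  have mu_t z : tbl (mu z) = tbl (mu x) -> mu z = t.
    by move=> zx; apply/set1P; rewrite -tE inE zx eqxx andbT;
      have /andP[] := mu_m z.
  by rewrite -(muK x) -(muK y) (mu_t x) // (mu_t y).
have inj_mu : injective mu := can_inj muK.
pose B := perm mu_inj; apply/andP; split; apply/cards1P.
  exists (mu (B^-1 x)%g); apply/setP=> t; rewrite !inE.
  apply/andP/eqP => [[/imsetP[y _ ->] /eqP <-] | ->].
    by rewrite -[tbl _]/((@tbl n N G \o mu) y) -(permE mu_inj) permK.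
  rewrite imset_f //; split=> //.
  by rewrite -[tbl _]/((@tbl n N G \o mu) _) -(permE mu_inj) permKV.
exists (mu x); apply/setP=> t; rewrite !inE.
apply/andP/eqP => [[/imsetP[y _ ->] /eqP <-] | ->]; first by rewrite muK.
by rewrite muK imset_f.
Qed.

Section Matched.
Variables (m : {set tedge n G}) (mu : tvertex n N -> tedge n G).
Hypotheses (cG : ciliated G) (mu_m : matched m mu).

Local Notation edge_at := (fun x => tover (mu x)).

Let muK : cancel mu (@twh n N G). Proof. by case: mu_m. Qed.

Let mu_inj : injective (@tbl n N G \o mu). Proof. by case: mu_m. Qed.

Definition black_end : {perm tvertex n N} := perm mu_inj.

Lemma black_endE x : black_end x = tbl (mu x).
Proof. by rewrite permE. Qed.

Lemma twh_matched x : twh (mu x) = x.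
Proof. exact: muK. Qed.

Lemma wh_matched x : wh (tover (mu x)) = x.1.
Proof. exact: (congr1 fst (muK x)). Qed.

Lemma tw_matched x : tw (mu x) = x.2.
Proof. exact: (congr1 snd (muK x)). Qed.

Lemma bl_matched x : bl (tover (mu x)) = (black_end x).1.
Proof. by rewrite black_endE. Qed.

Lemma tb_matched x : tb (mu x) = (black_end x).2.
Proof. by rewrite black_endE. Qed.

Lemma mem_matched t : (t \in m) = (t == mu (twh t)).
Proof.
case: mu_m => -> _ _; apply/imsetP/eqP => [[x _ ->]|->]; first by rewrite muK.
by exists (twh t).
Qed.

Lemma mate_matched x : mate m x = Some (mu x).
Proof.
rewrite /mate; case: pickP => [t|/(_ (mu x))];
  last by rewrite mem_matched muK !eqxx.
by rewrite mem_matched => /andP[/eqP tE /eqP tx]; rewrite tE tx.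
Qed.

Lemma tsigma_matched : tsigma m = black_end.
Proof.
apply/permP=> x; rewrite /tsigma mkpermE ?mate_matched ?black_endE //.
by move=> y z; rewrite !mate_matched; apply: mu_inj.
Qed.

Lemma mem_S_ e l : (l \in S_ m e) = (edge_at (wh e, l) == e).
Proof.
apply/imsetP/eqP => [[t + ->] | el].
  rewrite inE mem_matched => /andP[/eqP tm /eqP <-].
  by rewrite -[(_, _)]/(twh t) -tm.
exists (mu (wh e, l)); last by rewrite tw_matched.
by rewrite inE mem_matched muK eqxx; apply/eqP.
Qed.

Lemma mem_T_ e k : (k \in T_ m e) = (edge_at ((black_end^-1)%g (bl e, k)) == e).
Proof.
apply/imsetP/eqP => [[t + ->] | ek].
  rewrite inE mem_matched => /andP[/eqP tm /eqP <-].
  by rewrite -[(_, _)]/(tbl t) {1}tm -black_endE permK -tm.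
set x := (black_end^-1)%g (bl e, k) in ek; exists (mu x);
  last by rewrite tb_matched permKV.
by rewrite inE mem_matched muK eqxx; apply/eqP.
Qed.

Lemma inv_vsigma_white w : inv_count (vsigma m (inr w)) =
  (\sum_(k < n) \sum_(l < n) ((index (edge_at (w, k)) (word G w) <
     index (edge_at (w, l)) (word G w)) && (l < k)))%N.
Proof.
apply: (inv_count_blocks (key := fun k => edge_at (w, k))) => [|k|e].
- exact: word_uniq.
- by rewrite mem_word // wh_matched.
- by rewrite mem_word // => /eqP <- k; rewrite mem_S_.
Qed.

Lemma inv_vsigma_black b (y := fun k => edge_at ((black_end^-1)%g (b, k))) :
  inv_count (vsigma m (inl b)) =
  (\sum_(k < n) \sum_(l < n) ((index (y k) (bord G b) <
     index (y l) (bord G b)) && (l < k)))%N.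
Proof.
apply: (inv_count_blocks (key := y)) => [|k|e].
- exact: bord_uniq.
- by rewrite mem_bord // bl_matched permKV.
- by rewrite mem_bord // => /eqP be k; rewrite mem_T_ be.
Qed.

Lemma hmapE e l : l \in S_ m e -> hmap m e l = tb (mu (wh e, l)).
Proof.
rewrite mem_S_ => /eqP el; rewrite /hmap; case: pickP => [t|/(_ (mu (wh e, l)))].
  rewrite mem_matched => /andP[/eqP -> /andP[/eqP te /eqP tl]] /=.
  by congr (tb (mu (_, _))); rewrite -?te -?tl ?wh_matched ?tw_matched.
by rewrite mem_matched muK el tw_matched !eqxx.
Qed.

Lemma hmap_inj e : {in S_ m e &, injective (hmap m e)}.
Proof.
move=> k l kS lS; rewrite !hmapE // => kl.
suff: (wh e, k) = (wh e, l) by case.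
apply: mu_inj; rewrite /= /tbl kl.
by move: kS lS; rewrite !mem_S_ => /eqP -> /eqP ->.
Qed.

Lemma T_imset e : T_ m e = hmap m e @: S_ m e.
Proof.
apply/setP=> k; rewrite mem_T_; set x := (black_end^-1)%g _.
apply/eqP/imsetP => [xe | [l lS kl]].
  have xl : (wh e, x.2) = x by rewrite -xe wh_matched -surjective_pairing.
  have xS : x.2 \in S_ m e by rewrite mem_S_ xl xe.
  by exists x.2 => //; rewrite hmapE // xl tb_matched permKV.
rewrite /x kl hmapE //; have := lS; rewrite mem_S_ => /eqP le.
have -> : (bl e, tb (mu (wh e, l))) =
  black_end (wh e, l) by rewrite black_endE /tbl le.
by rewrite permK.
Qed.

Lemma card_T_ e : #|T_ m e| = #|S_ m e|.
Proof. by rewrite T_imset (card_in_imset (@hmap_inj e)). Qed.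

Lemma index_enum_val (T : finType) (A : {set T}) (a : 'I_#|A|) :
  index (enum_val a) (enum A) = a.
Proof.
by rewrite (enum_val_nth (enum_val a)) index_uniq ?enum_uniq // -cardE.
Qed.

Lemma esigmaE e a : esigma m e a =
  index (hmap m e (enum_val a)) (enum (T_ m e)) :> nat.
Proof.
have ltT (b : 'I_#|S_ m e|) : (index (hmap m e (enum_val b)) (enum (T_ m e)) <
  #|S_ m e|)%N.
  by rewrite -card_T_ cardE index_mem mem_enum T_imset imset_f // enum_valP.
rewrite /esigma mkpermE => [|b c]; first by rewrite val_insubd ltT.
move=> /(congr1 val); rewrite !val_insubd !ltT => bc.
apply/enum_val_inj/(@hmap_inj e); rewrite ?enum_valP //.
have memT (d : 'I_#|S_ m e|) : hmap m e (enum_val d) \in enum (T_ m e).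
  by rewrite mem_enum T_imset imset_f // enum_valP.
by rewrite -(nth_index (enum_val b) (memT b)) bc nth_index.
Qed.

(** The bijections onto ranks are increasing, so inversions can be read directly on the indices in
    the blow-up. *)
Lemma inv_esigma e : inv_count (esigma m e) =
  (\sum_(x | edge_at x == e) \sum_(y | edge_at y == e)
     ((x.2 < y.2) && (tb (mu y) < tb (mu x))))%N.
Proof.
have sumS (F : tvertex n N -> nat) :
    (\sum_(x | edge_at x == e) F x = \sum_(a < #|S_ m e|) F (wh e, enum_val a))%N.
  rewrite (reindex_onto (fun l => (wh e, l)) snd) => [|x /eqP <-]; last first.
    by rewrite wh_matched -surjective_pairing.
  rewrite -(big_enum_val (fun l => F (wh e, l))).
  by apply: eq_bigl => l; rewrite mem_S_ eqxx andbT.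
rewrite inv_countE sumS; apply: eq_bigr => a _; rewrite sumS;
  apply: eq_bigr => b _ /=.
rewrite -(index_enum_lt (enum_valP a) (enum_valP b)) !index_enum_val !esigmaE.
rewrite index_enum_lt ?T_imset ?imset_f ?enum_valP // !hmapE ?enum_valP //.
Qed.

Lemma sum_inv_esigma : (\sum_e inv_count (esigma m e) =
  \sum_x \sum_y [&& edge_at x == edge_at y, x.2 < y.2 & tb (mu y) < tb (mu x)])%N.
Proof.
rewrite [RHS](partition_big (fun x => edge_at x) predT) //=.
apply: eq_bigr => e _; rewrite inv_esigma; apply: eq_bigr => x /eqP xe.
by rewrite [LHS]big_mkcond; apply: eq_bigr => y _; rewrite xe eq_sym; case: eqP.
Qed.

Local Notation lexV p := (lexr (fun x : tvertex n N => x.1 : nat)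
  (lexr p (fun x y : tvertex n N => (x.2 < y.2)%N))).

(** Both orders compare first coordinates first, so they can only disagree inside a fibre. With [p]
    the position of the half-edge, the right side is a sum of lengths of the [vsigma]. *)
Lemma discord_fibers (p : tvertex n N -> nat) :
  discord (lexV p) (lexV (fun=> 0%N)) =
  (\sum_(w < N) \sum_(k < n) \sum_(l < n) ((p (w, k) < p (w, l)) && (l < k))%N)%:R.
Proof.
rewrite natr_sum /discord big_pairE; apply: eq_bigr => w _.
rewrite natr_sum; apply: eq_bigr => k _; rewrite natr_sum big_pairE.
rewrite (bigD1 w) //= [X in _ + X]big1 ?addr0 => [|u uw].
  apply: eq_bigr => l _; rewrite /lexr /= !eqxx !ltnn /=.
  by case: ltngtP => //= _; case: ltngtP.
apply: big1 => l _; rewrite /lexr /=.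
by case: (ltngtP w u) => //= /ord_inj wu; rewrite wu eqxx in uw.
Qed.

Lemma tsigma_sign :
  (tsigma m : bool)%:R + (\sum_v inv_count (vsigma m v))%:R
    + (\sum_e inv_count (esigma m e))%:R =
  quad (@wbefore N G) (@bbefore N G) (fun e => (mult m e)%:R) :> 'F_2.
Proof.
rewrite tsigma_matched.
pose pW x := pos (@wh N G) (@word N G) (edge_at x).
pose pB x := pos (@bl N G) (@bord N G) (edge_at x).
(* [W1] and [B1] are the lexicographic orders of the white and black ends; [W2]
   and [B2] first compare the positions of the half-edges.  [W1 -> W2] and
   [B2 -> B1] count the inversions of the [vsigma], [W2 -> B2] those of the
   [esigma] and those between distinct edges of [G]. *)
pose W1 := lexV (fun=> 0%N); pose W2 := lexV pW.
pose B1 : rel (tvertex n N) := fun x y => W1 (black_end x) (black_end y).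
pose B2' := lexV (fun x => pB ((black_end^-1)%g x)).
pose B2 : rel (tvertex n N) := fun x y => B2' (black_end x) (black_end y).
have val2_inj (x y : tvertex n N) : x.1 = y.1 -> x.2 = y.2 -> x = y.
  by case: x y => [? ?] [? ?] /= -> ->.
have lexV_tournament p : tournament (lexV p).
  move=> x y; apply: lexr_asym => /ord_inj xy1; apply: lexr_asym => _.
  by apply: (ltn_asym (f := fun z : tvertex n N => z.2 : nat)) => /ord_inj;
    apply: val2_inj.
have t1 : tournament W1 by apply: lexV_tournament.
have t2 : tournament W2 by apply: lexV_tournament.
have tB1 : tournament B1 by apply: tournament_comp.
have tB2 : tournament B2 by apply: (tournament_comp black_end (lexV_tournament _)).
have oddE : (odd_perm black_end)%:R = discord W2 W1 + discord W2 B2 + discord B2 B1.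
  rewrite -addrA -(discord_trans t2 tB2 tB1) (discord_trans t2 t1 tB1) addrA
    F2_addxx add0r.
  exact: odd_perm_discord.
have vE : (\sum_v inv_count (vsigma m v))%:R = discord B2 B1 + discord W2 W1.
  rewrite big_sumType /= natrD; congr (_ + _); last first.
    rewrite discord_fibers; congr (_%:R); apply: eq_bigr => w _.
    rewrite inv_vsigma_white; apply: eq_bigr => k _; apply: eq_bigr => l _.
    by rewrite /pW /pos !wh_matched.
  rewrite /B2 /B1 discord_comp discord_fibers; congr (_%:R); apply: eq_bigr => b _.
  rewrite inv_vsigma_black; apply: eq_bigr => k _; apply: eq_bigr => l _.
  by rewrite /pB /pos !bl_matched !permKV.
rewrite oddE vE sum_inv_esigma.
set a := discord W2 W1; set b := discord B2 B1; set c := discord W2 B2;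
  set d := _%:R.
have -> : a + c + b + (b + a) + d = (a + a) + (b + b) + (c + d) by ring.
rewrite !F2_addxx !add0r.
pose kappa (e f : edge G) : 'F_2 := (wbefore e f && bbefore f e)%:R.
have -> : c = \sum_x \sum_y kappa (edge_at x) (edge_at y) + d.
  rewrite /c /d /discord natr_sum -big_split; apply: eq_bigr => x _.
  rewrite natr_sum -big_split; apply: eq_bigr => y _ /=.
  have -> : W2 x y = wbefore (edge_at x) (edge_at y) || (edge_at x == edge_at
    y) && (x.2 < y.2)%N.
    rewrite -(lexr_beforeE (mem_word cG) edge_at (fun x y => (x.2 < y.2)%N)).
    by rewrite /W2 /lexr /pW !wh_matched.
  have -> : B2 y x = bbefore (edge_at y) (edge_at x) ||
      (edge_at y == edge_at x) && (tb (mu y) < tb (mu x))%N.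
    rewrite -(lexr_beforeE (mem_bord cG) edge_at (fun x y =>
      (tb (mu x) < tb (mu y))%N)).
    by rewrite /B2 /B2' /lexr /pB !permK !bl_matched !tb_matched.
  rewrite /kappa [edge_at y == _]eq_sym; case: eqVneq => [->|_];
    last by rewrite !orbF addr0.
  by rewrite (tournament_irr _ (wbefore_tournament cG)) (tournament_irr _
    (bbefore_tournament cG)) add0r.
rewrite -addrA F2_addxx addr0.
(* [kappa] only sees edges of [G], so the remaining sum depends on the matching through its
   multiplicities alone. *)
have sum_mult (g : edge G ->
  'F_2) : \sum_e (mult m e)%:R * g e = \sum_x g (edge_at x).
  rewrite [RHS](partition_big edge_at predT) //=; apply: eq_bigr => e _.
  rewrite (eq_bigr (fun=> g e)) => [|x /eqP -> //]; rewrite sumr_const.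
  rewrite -[RHS]mulr_natl; congr (_ * _); congr (_%:R).
  rewrite /mult; case: mu_m => mE _ _.
  rewrite -(card_imset _ (can_inj muK)); apply: eq_card => t; rewrite !inE mE.
  apply/andP/imsetP => [[/imsetP[x _ ->] xe]|[x xe ->]]; first by exists x.
  by rewrite imset_f.
rewrite /quad -(sum_mult (fun e => \sum_y kappa e (edge_at y)));
  apply: eq_bigr => e _.
rewrite -(sum_mult (kappa e)) mulr_sumr; apply: eq_bigr => f _.
by rewrite mulrA.
Qed.

End Matched.
End Matching.
(** * Straightening the trace *)

Section Swap.
Variables (i k : nat) (f g : nat -> nat).
Let sw j := if j == i then i.+1 else if j == i.+1 then i else j.
Hypotheses (ik : (i < k)%N) (gE : forall j, (j <= k)%N -> g j = f (sw j)).

(** One insertion step: exchanging the entries at [i] and [i.+1] moves the entry that may be out of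
    order from [i.+1] down to [i]. *)
Lemma increasing_swap :
  ((forall a b, (a < b)%N -> (b <= k)%N -> b != i.+1 ->
    (g a < g b)%N) /\ (g i.+1 < g i)%N)
  <-> (forall a b, (a < b)%N -> (b <= k)%N -> b != i -> (f a < f b)%N).
Proof.
have fE j : (j <= k)%N -> f j = g (sw j).
  move=> jk; rewrite gE /sw; last by do 2?case: eqP; lia.
  by congr f; do 4?case: eqP; lia.
have swi : sw i = i.+1 by rewrite /sw eqxx.
have swi1 : sw i.+1 = i by rewrite /sw eqxx; case: eqP => //; lia.
have swo b : b != i -> b != i.+1 -> sw b = b by rewrite /sw => /negPf-> /negPf->.
have sw_lt a b : (a < b)%N -> b != i -> b != i.+1 -> (sw a < b)%N.
  by move=> ab /eqP bi /eqP bi1; rewrite /sw; do 2?case: eqP; lia.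
split=> [[inc lt] a b ab bk bi | inc].
  rewrite !fE //; last lia; case: (eqVneq b i.+1) => [bE|bi1].
    rewrite bE swi1; case: (eqVneq a i) => [->|ai]; first by rewrite swi.
    by rewrite swo //; [apply: inc|]; lia.
  by rewrite (swo b) //; apply: inc => //; apply: sw_lt.
split=> [a b ab bk bi1|]; last by rewrite !gE ?swi ?swi1 ?inc //; lia.
rewrite !gE //; last lia; case: (eqVneq b i) => [bE|bi].
  by rewrite bE swi swo; [apply: inc| |]; lia.
by rewrite (swo b) //; apply: inc => //; apply: sw_lt.
Qed.

End Swap.

(** * Insertion sort with a scalar for each exchange *)

Section Sorting.
Variables (K : nzRingType) (V : lmodType K) (X : finType) (m : nat) (c : K).
Variables (col : X -> nat -> nat) (tau : nat -> X -> X) (P : pred X) (F : X -> V).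

Definition increasing_upto k x :=
  [forall b : 'I_k, forall a : 'I_b, (col x a < col x b)%N].

(* Increasing on [0..k], except that the entry at [i] may be smaller than some
   of the entries before it. *)
Let dropped k i x :=
  [forall b : 'I_k.+1, (val b != i) ==> [forall a : 'I_b, (col x a < col x b)%N]].

Lemma increasing_uptoP k x :
  reflect (forall a b, (a < b)%N -> (b < k)%N -> (col x a < col x b)%N)
          (increasing_upto k x).
Proof.
apply: (iffP forallP) => [inc a b ab bk | inc b]; last first.
  by apply/forallP=> -[a ab]; apply: inc; last case: b {ab}.
by have /forallP/(_ (Ordinal ab)) := inc (Ordinal bk).
Qed.

Let droppedP k i x :
  reflect (forall a b, (a < b)%N -> (b <= k)%N -> b != i -> (col x a < col x b)%N)
          (dropped k i x).
Proof.
apply: (iffP forallP) => [inc a b ab bk bi | inc b]; last first.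
  by apply/implyP=> bi; apply/forallP=> -[a ab]; apply: inc bi => //;
    rewrite -ltnS ltn_ord.
have := inc (Ordinal (bk : (b < k.+1)%N)); rewrite /= bi => /forallP.
by move=> /(_ (Ordinal ab)).
Qed.

Hypotheses (tauK : forall i, (i.+1 < m)%N -> involutive (tau i))
  (col_tau : forall i x j, (i.+1 < m)%N -> (j < m)%N ->
     col (tau i x) j = col x (if j == i then i.+1 else if j == i.+1 then i else j))
  (col_inj : forall x i j, (i < m)%N -> (j < m)%N -> col x i = col x j -> i = j)
  (P_tau : forall i x, (i.+1 < m)%N -> P (tau i x) = P x)
  (F_tau : forall i x, (i.+1 < m)%N -> (col x i < col x i.+1)%N ->
     F (tau i x) = c *: F x).

Let dropped_sorted k i x : (i < k)%N ->
  dropped k i.+1 x && (col x i < col x i.+1)%N = increasing_upto k.+1 x.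
Proof.
move=> ik; apply/andP/increasing_uptoP => [[/droppedP inc ltii] a b ab bk|inc].
  case: (eqVneq b i.+1) => [bi|]; last exact: inc.
  have [ai|ai] : a = i \/ (a < i)%N by lia.
    by rewrite ai bi.
  rewrite bi; apply: ltn_trans ltii; apply: inc => //; lia.
split; last by apply: inc.
by apply/droppedP => a b ab bk _; apply: inc.
Qed.

Let dropped_tau k i x : (i < k)%N -> (k < m)%N ->
  dropped k i.+1 (tau i x) && ~~ (col (tau i x) i < col (tau i x) i.+1)%N =
  dropped k i x.
Proof.
move=> ik km; have im : (i.+1 < m)%N by lia.
have colE j : (j <= k)%N -> col (tau i x) j =
    col x (if j == i then i.+1 else if j == i.+1 then i else j).
  by move=> jk; apply: col_tau => //; lia.
have [to from] := increasing_swap ik colE.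
apply/andP/droppedP => [[/droppedP inc nlt]|/from[inc lt]].
  apply: to; split=> //; rewrite ltn_neqAle leqNgt nlt andbT.
  by apply/eqP => /(col_inj im (ltnW im)); lia.
by split; [apply/droppedP | rewrite -leqNgt ltnW].
Qed.

(** The entry out of order moves down until it fits, and each exchange costs a factor [c]; the
    exponent [t] counts the exchanges. *)
Let sum_dropped k i : (i <= k)%N -> (k < m)%N ->
  \sum_(x | P x && dropped k i x) F x =
  (\sum_(0 <= t < i.+1) c ^+ t) *: \sum_(x | P x && increasing_upto k.+1 x) F x.
Proof.
move=> + km; elim: i => [_|i IHi ik].
  rewrite big_nat1 scale1r; apply: eq_bigl => x; congr (_ && _).
  apply/droppedP/increasing_uptoP => inc a b ab bk; last by move=> _; apply: inc.
  by apply: inc => //; case: b ab {bk}.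
rewrite (bigID (fun x => col x i < col x i.+1)%N) /=.
rewrite (eq_bigl (fun x => P x && increasing_upto k.+1 x)) => [|x]; last first.
  by rewrite -andbA dropped_sorted.
rewrite [X in _ + X](reindex_inj (inv_inj (tauK (leq_ltn_trans ik km)))) /=.
rewrite [X in _ + X](eq_bigl (fun x => P x && dropped k i x)) => [|x]; last first.
  by rewrite -andbA dropped_tau // P_tau //; apply: leq_ltn_trans ik km.
rewrite [X in _ + X](eq_bigr (fun x => c *: F x)) =>
  [|x /andP[_ /droppedP inc]]; last first.
  have im := leq_ltn_trans ik km.
  by apply: F_tau => //; apply: inc => //; lia.
rewrite -scaler_sumr IHi ?(ltnW ik) // scalerA big_nat_recl //= expr0 mulr_sumr.
rewrite scalerDl scale1r; congr (_ + _ *: _).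
by apply: eq_bigr => t _; rewrite exprS.
Qed.

(** Entries are inserted one at a time: entry [k] has [k.+1] possible places among its predecessors,
    whence the factor of index [k]. *)
Lemma sum_sorted : \sum_(x | P x) F x =
  (\prod_(0 <= k < m) \sum_(0 <= t < k.+1) c ^+ t) *:
    \sum_(x | P x && increasing_upto m x) F x.
Proof.
have: (m <= m)%N by []; elim: {1 3 4}m => [_|k IHk km].
  rewrite big_geq // scale1r; apply: eq_bigl => x.
  by rewrite (_ : increasing_upto 0 x) ?andbT //; apply/increasing_uptoP.
rewrite IHk ?(ltnW km) // big_nat_recr //= -scalerA; congr (_ *: _).
rewrite -(@sum_dropped k k) //; apply: eq_bigl => x; congr (_ && _).
apply/increasing_uptoP/droppedP => inc a b ab bk; last by apply: inc; lia.
by move=> bk'; apply: inc => //; lia.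
Qed.

End Sorting.

Lemma inv_count_swap (n : nat) (s : 'S_n) (i j : 'I_n) :
    j = i.+1 :> nat -> (s i < s j)%N ->
  inv_count (tperm i j * s)%g = (inv_count s).+1.
Proof.
move=> ji lt_ij; rewrite !inv_countE.
rewrite (reindex_inj (@perm_inj _ (tperm i j))) /=.
under eq_bigr => a _.
  rewrite (reindex_inj (@perm_inj _ (tperm i j))) /=.
  under eq_bigr => b _ do rewrite !permM !tpermK.
  over.
have -> : (forall a : nat, a.+1 = a + 1)%N by move=> a; rewrite addn1.
(* After reindexing both sums, [(j, i)] is the only pair whose status changes, because no index lies
   between [i] and [j]. *)
have -> : 1%N = (\sum_(a < n) \sum_(b < n) ((a == j) && (b == i)))%N.
  rewrite (bigD1 j) //= [X in (X + _)%N](bigD1 i) //= !eqxx /= !big1 //.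
    by move=> a /negPf->; rewrite big1.
  by move=> b /negPf->.
rewrite -big_split; apply: eq_bigr => a _; rewrite -big_split;
  apply: eq_bigr => b _ /=.
have neq (k l : 'I_n) : k != l -> k <> l :> nat by move=> /eqP kl /val_inj.
case: tpermP => [->|->|/eqP/neq ai /eqP/neq aj];
  case: tpermP => [->|->|/eqP/neq bi /eqP/neq bj];
  rewrite ?eqxx ?ltnn //= -?val_eqE /=; lia.
Qed.

(** * Permutations at vertices as colourings of half-edges *)

Section Placement.
Variables (n N : nat) (C : finType) (v : C -> 'I_N) (L : 'I_N -> seq C).
Hypotheses (uniqL : forall w, uniq (L w))
           (memL : forall w c, (c \in L w) = (v c == w))
           (sizeL : forall w, size (L w) = n).
Implicit Types s : {ffun 'I_N -> 'S_n}.

Lemma place_subproof c : (pos v L c < n)%N.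
Proof. by rewrite -(sizeL (v c)) pos_lt. Qed.

Definition place c : 'I_n := Ordinal (place_subproof c).

(** Permutations at the vertices are the same as colourings bijective at every vertex; see
    [color_ext] and [color_complete]. *)
Definition color s c : 'I_n := s (v c) (place c).

Definition swap c d s : {ffun 'I_N -> 'S_n} :=
  [ffun w => if w == v c then (tperm (place c) (place d) * s w)%g else s w].

Definition inv_total s : nat := (\sum_w inv_count (s w))%N.

Lemma place_inj c d : v c = v d -> place c = place d -> c = d.
Proof. by move=> vcd /(congr1 val); apply: pos_inj. Qed.

Lemma place_surj w i : exists2 c, v c = w & place c = i.
Proof.
have iL : (i < size (L w))%N by rewrite sizeL.
have [c0] : exists c0, c0 \in L w.
  by case: (L w) iL => // c0 l _; exists c0; apply: mem_head.
have vi : v (nth c0 (L w) i) = w by apply/eqP; rewrite -memL mem_nth.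
exists (nth c0 (L w) i) => //; apply: val_inj.
by rewrite /= /pos vi index_uniq.
Qed.

Lemma color_swap c d s e : v c = v d ->
  color (swap c d s) e = color s (tperm c d e).
Proof.
move=> vcd; rewrite /color /swap ffunE.
case: tpermP => [->|->|ec ed]; rewrite -?vcd ?eqxx ?permM ?tpermL ?tpermR //.
case: eqP => // vec; rewrite permM tpermD // eq_sym.
  by apply/eqP => /(place_inj vec).
by apply/eqP => /place_inj-/(_ _)/ed; apply; rewrite vec.
Qed.

Lemma swapK c d : involutive (swap c d).
Proof.
move=> s; apply/ffunP=> w; rewrite !ffunE; case: eqP => // _.
by rewrite mulgA tperm2 mul1g.
Qed.

Lemma color_inj s c d : v c = v d -> color s c = color s d -> c = d.
Proof. by rewrite /color => vcd; rewrite vcd => /perm_inj/(place_inj vcd). Qed.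

Lemma color_ext s s' : color s =1 color s' -> s = s'.
Proof.
move=> ss'; apply/ffunP=> w; apply/permP=> i.
by have [c <- <-] := place_surj w i; apply: ss'.
Qed.

Lemma color_complete (f : C -> 'I_n) :
  (forall c d, v c = v d -> f c = f d -> c = d) -> exists s, color s =1 f.
Proof.
move=> f_inj; exists [ffun w => perm_of_list (map f (L w))] => c.
rewrite /color ffunE -perm_of_listE ?size_map ?sizeL //; last first.
  rewrite map_inj_in_uniq // => a b; rewrite !memL => /eqP av /eqP bv.
  by apply: f_inj; rewrite av.
by rewrite (nth_map c) ?index_mem ?memL //= nth_index ?memL.
Qed.

Lemma inv_total_swap c d s : v c = v d -> pos v L d = (pos v L c).+1 ->
  (color s c < color s d)%N -> inv_total (swap c d s) = (inv_total s).+1.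
Proof.
move=> vcd pcd lt_cd;
  rewrite /inv_total (bigD1 (v c)) //= [in RHS](bigD1 (v c)) //=.
rewrite ffunE eqxx inv_count_swap //; last by rewrite /color -vcd in lt_cd.
by rewrite addSn; congr (_ + _).+1; apply: eq_bigr => w /negPf wc; rewrite ffunE wc.
Qed.

Lemma color_holder s :
  exists h : 'I_N * 'I_n -> C, forall x, v (h x) = x.1 /\ color s (h x) = x.2.
Proof.
suff /fin_all_exists[h hE] (x : 'I_N * 'I_n) : exists c, v c =
  x.1 /\ color s c = x.2.
  by exists h.
case: x => w k; have [c cw ck] := place_surj w ((s w)^-1%g k).
by exists c; rewrite /color cw ck permKV.
Qed.

(** Inversions are read by colours, [h] naming the half-edge of each colour, to match the formulas
    for [vsigma]. *)
Lemma inv_count_color s (h : 'I_N * 'I_n -> C) w :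
    (forall x, v (h x) = x.1 /\ color s (h x) = x.2) ->
  inv_count (s w) = (\sum_(k < n) \sum_(l < n)
    ((pos v L (h (w, k)) < pos v L (h (w, l))) && (l < k)))%N.
Proof.
move=> hE; have posE i : pos v L (h (w, s w i)) = i.
  have [hw hi] := hE (w, s w i); move: hi; rewrite /color hw /= => /perm_inj.
  by move=> /(congr1 val).
rewrite inv_countE [RHS](reindex_inj (@perm_inj _ (s w))); apply: eq_bigr => i _.
rewrite [RHS](reindex_inj (@perm_inj _ (s w))); apply: eq_bigr => j _.
by rewrite !posE.
Qed.

End Placement.

Section CopyLists.
Variables (N : nat) (G : cgraph N) (m : edge G -> nat).

Local Notation block e := [seq Tagged (fun f => 'I_(m f)) c | c <- enum 'I_(m e)].

Lemma tag_block (e : edge G) c : c \in block e -> tag c = e.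
Proof. by case/mapP=> i _ ->. Qed.

Lemma mem_block c : c \in block (tag c).
Proof. by case: c => e i; rewrite map_f // mem_enum. Qed.

Lemma Tagged_copy_inj e : injective (Tagged (fun f => 'I_(m f)) : 'I_(m e) ->
  copies m).
Proof. by move=> i j /eqP; rewrite eq_Tagged => /eqP. Qed.

Lemma index_block e (i : 'I_(m e)) :
  index (Tagged (fun f => 'I_(m f)) i) (block e) = i.
Proof.
by rewrite index_map ?index_enum_ord //; apply: Tagged_copy_inj.
Qed.

Lemma mem_copies_list s c : (c \in copies_list m s) = (tag c \in s).
Proof. by apply: (mem_flatten_map (key := tag)) (mem_block c) => e _;
  apply: tag_block. Qed.

Lemma uniq_copies_list s : uniq s -> uniq (copies_list m s).
Proof.
move=> us; apply: (uniq_flatten_map (key := tag) us) => e _; last exact: tag_block.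
by rewrite map_inj_uniq ?enum_uniq //; apply: Tagged_copy_inj.
Qed.

Lemma size_copies_list s : size (copies_list m s) = (\sum_(e <- s) m e)%N.
Proof.
elim: s => [|e s IHs]; rewrite ?big_nil // big_cons -IHs /copies_list /=.
by rewrite size_cat size_map size_enum_ord.
Qed.

Lemma index_copies_list s c d : tag c \in s -> tag d \in s ->
  (index c (copies_list m s) < index d (copies_list m s))%N =
  (index (tag c) s < index (tag d) s)%N || (tag c == tag d) && (tagged c <
    tagged d)%N.
Proof.
move=> cs ds; rewrite /copies_list (index_flatten_map (key := tag)) ?mem_block
  //; last first.
  by move=> e _; apply: tag_block.
congr (_ || _); case: c d {cs ds} => [e i] [f j] /=.
by case: eqP j => //= <- j; rewrite !index_block.
Qed.

Lemma index_copies_list_succ s e (i j : 'I_(m e)) : e \in s -> j = i.+1 :> nat ->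
  index (Tagged (fun f => 'I_(m f)) j) (copies_list m s) =
  (index (Tagged (fun f => 'I_(m f)) i) (copies_list m s)).+1.
Proof.
move=> es ji; elim: s es => // f s IHs; rewrite inE /copies_list /= !index_cat.
case: (eqVneq e f) => [<- _|ef /= es].
  by rewrite !mem_block !index_block.
have nblock (k : 'I_(m e)) : (Tagged (fun g =>
  'I_(m g)) k : copies m) \in block f = false.
  by apply: contraNF ef => /tag_block kf; apply/eqP.
by rewrite !nblock IHs ?addnS.
Qed.

Hypothesis cG : ciliated G.

Lemma multiply_ciliated : ciliated (multiply m).
Proof.
by split=> x; split=> [|e]; rewrite ?uniq_copies_list ?mem_copies_list ?bord_uniq
  ?word_uniq ?mem_bord ?mem_word.
Qed.

Variable n : nat.
Hypothesis sum_m : forall v : vertex N, (\sum_(e | incident e v) m e = n)%N.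

Lemma size_word_multiply w : size (word (multiply m) w) = n.
Proof.
rewrite /= size_copies_list big_uniq ?word_uniq //= -(sum_m (inr w)).
by apply: eq_bigl => e; rewrite mem_word.
Qed.

Lemma size_bord_multiply b : size (bord (multiply m) b) = n.
Proof.
rewrite /= size_copies_list big_uniq ?bord_uniq //= -(sum_m (inl b)).
by apply: eq_bigl => e; rewrite mem_bord.
Qed.

End CopyLists.

Section Trace.
Variables (R : realType) (q : R[i]) (A : algType R[i]) (n N : nat) (H : cgraph N).
Variable Psi : edge H -> 'M[A]_n.
Hypotheses (cH : ciliated H) (size_word : forall w, size (word H w) = n)
           (size_bord : forall b, size (bord H b) = n).

Local Notation config := {ffun 'I_N -> 'S_n}.

Definition wcolor (s : config) c := color (mem_word cH) size_word s c.
Definition bcolor (s : config) c := color (mem_bord cH) size_bord s c.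

Definition web_entry (sw sb : config) (c : edge H) : A := Psi c (wcolor sw c)
  (bcolor sb c).

Definition web_term (sw sb : config) : A :=
  (- q) ^+ (inv_total sw + inv_total sb) *:
  \prod_(w < N) \prod_(c <- word H w) web_entry sw sb c.

Lemma trace_graph_web_term :
  trace_graph q Psi = \sum_sw \sum_sb web_term sw sb.
Proof.
pose join (p : config * config) : {ffun vertex N -> 'S_n} :=
  [ffun v => match v with inl b => p.2 b | inr w => p.1 w end].
pose split (s : {ffun vertex N -> 'S_n}) : config * config :=
  ([ffun w => s (inr w)], [ffun b => s (inl b)]).
rewrite /trace_graph (reindex join); last first.
  apply: onW_bij; exists split => [[sw sb]|s].
    by congr (_, _); apply/ffunP=> x; rewrite !ffunE.
  by apply/ffunP=> -[x|x]; rewrite !ffunE.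
rewrite pair_bigA; apply: eq_bigr => -[sw sb] _ /=; rewrite /web_term;
  congr (_ *: _).
  rewrite big_sumType /= mulrC exprD /inv_total.
  rewrite !expr_sum; congr (_ * _); apply: eq_bigr => x _; by rewrite ffunE.
apply: eq_bigr => w _.
(* A product along the list of half-edges, unlike one over positions, can be cut at a given
   half-edge. *)
have onthE (l : seq (edge H)) : \prod_(c <- l) web_entry sw sb c =
    \prod_(k < size l) oapp (web_entry sw sb) 0 (onth l k).
  elim: l => [|c l IHl]; rewrite ?big_nil ?big_ord0 // big_cons big_ord_recl IHl.
  by [].
rewrite onthE size_word; apply: eq_bigr => k _; rewrite /trace_entry.
case Lk: (onth _ _) => [c|] //=.
have kc : index c (word H w) = k /\ c \in word H w.
  have lt_k : (k < size (word H w))%N by rewrite size_word.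
  have ck : nth c (word H w) k = c by apply: onth_nth.
  by rewrite -{1 2}ck index_uniq ?(word_uniq cH) // mem_nth.
have wc : wh c = w by apply/eqP; rewrite -(mem_word cH) kc.2.
rewrite !ffunE /web_entry; congr (Psi c _ _).
  by rewrite /wcolor /color wc; congr (sw w _); apply: val_inj;
    rewrite /= /pos wc kc.1.
rewrite /bcolor /color; congr (sb _ _); apply: val_inj; rewrite val_insubd.
by rewrite (place_subproof (mem_bord cH) size_bord c).
Qed.

End Trace.

Lemma split_successive (T : eqType) (l : seq T) c d : c \in l -> d \in l ->
  index d l = (index c l).+1 -> exists s1 s2, l = s1 ++ c :: d :: s2.
Proof.
move=> cl dl dc; exists (take (index c l) l), (drop (index c l).+2 l).
rewrite -[LHS](cat_take_drop (index c l)); congr (_ ++ _).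
rewrite (drop_nth c) ?index_mem // nth_index //; congr (_ :: _).
by rewrite -dc (drop_nth c) ?index_mem // nth_index.
Qed.

(** * The exchange relation for copies of an edge *)

Section Straightening.
Variables (R : realType) (q : R[i]) (A : algType R[i]) (n N : nat) (G : cgraph N).
Variables (Phi : edge G -> 'M[A]_n) (m : edge G -> nat).
Hypotheses (q_neq0 : q != 0) (cG : ciliated G)
  (sum_m : forall v : vertex N, (\sum_(e | incident e v) m e = n)%N)
  (qPhi : forall e, quantum_matrix q (Phi e)).

Local Notation H := (multiply m).
Local Notation cH := (multiply_ciliated m cG).
Local Notation size_w := (size_word_multiply cG sum_m).
Local Notation size_b := (size_bord_multiply cG sum_m).
Local Notation Psi := (fun c : edge H => Phi (tag c)).
Local Notation config := {ffun 'I_N -> 'S_n}.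
Local Notation wcol := (@wcolor n N H cH size_w).
Local Notation bcol := (@bcolor n N H cH size_b).
Local Notation wswap := (swap (mem_word cH) size_w).
Local Notation bswap := (swap (mem_bord cH) size_b).
Local Notation entry := (web_entry Psi cH size_w size_b).
Local Notation term := (web_term q Psi cH size_w size_b).

Definition row_sum (sw : config) : A := \sum_sb term sw sb.

Let copy e (i : 'I_(m e)) : edge H := Tagged (fun f => 'I_(m f)) i.

Section SwapCopies.
Variables (e : edge G) (i j : 'I_(m e)).
Hypothesis ji : j = i.+1 :> nat.
Local Notation c := (copy i).
Local Notation d := (copy j).

Let wpos_succ : pos (@wh N H) (@word N H) d = (pos (@wh N H) (@word N H) c).+1.
Proof. by apply: index_copies_list_succ; rewrite ?mem_word. Qed.

Let bpos_succ : pos (@bl N H) (@bord N H) d = (pos (@bl N H) (@bord N H) c).+1.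
Proof. by apply: index_copies_list_succ; rewrite ?mem_bord. Qed.

Lemma wcol_swap sw x : wcol (wswap c d sw) x = wcol sw (tperm c d x).
Proof. exact: color_swap. Qed.

Lemma bcol_swap sb x : bcol (bswap c d sb) x = bcol sb (tperm c d x).
Proof. exact: color_swap. Qed.

(** Successive copies are neighbours in the list of their white vertex, hence adjacent factors of
    the non-commutative product. The other factors do not involve [c] or [d], so exchanging the
    colours of these two leaves them unchanged. *)
Lemma prod_entries : exists s1 s2 : seq (edge H),
  [/\ c \notin s1 ++ s2, d \notin s1 ++ s2 & forall sw sb,
  \prod_(w < N) \prod_(x <- word H w) entry sw sb x =
  \prod_(x <- s1) entry sw sb x * (entry sw sb c * entry sw sb d)
  * \prod_(x <- s2) entry sw sb x].
Proof.
have [s1 [s2 Lw]] : exists s1 s2, word H (wh c) = s1 ++ c :: d :: s2.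
  by apply: split_successive; rewrite ?(mem_word cH) //; apply: wpos_succ.
have [w1 [w2 enumE]] : exists w1 w2, index_enum 'I_N = w1 ++ wh c :: w2.
  by case/splitPr: (mem_index_enum (wh c)) => w1 w2; exists w1, w2.
have uW : uniq (flatten [seq word H w | w <- index_enum 'I_N]).
  apply: (uniq_flatten_map (key := @wh N H)); first exact: index_enum_uniq.
    by move=> w _; apply: (word_uniq cH w).
  by move=> w _ x; rewrite (mem_word cH) => /eqP.
pose t1 := flatten [seq word H w | w <- w1];
  pose t2 := flatten [seq word H w | w <- w2].
have WE : flatten [seq word H w | w <- index_enum 'I_N] =
  t1 ++ (s1 ++ c :: d :: s2) ++ t2.
  by rewrite enumE map_cat flatten_cat -Lw.
exists (t1 ++ s1), (s2 ++ t2).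
have {}uW : uniq ([:: c; d] ++ (t1 ++ s1) ++ s2 ++ t2).
  move: uW; rewrite WE; congr is_true; apply: perm_uniq.
  rewrite -[c :: d :: s2]/([:: c; d] ++ s2) -!catA catA.
  by rewrite perm_catCA -!catA perm_refl.
split=> [||sw sb].
- by move: uW; rewrite /= inE negb_or => /andP[/andP[_]].
- by move: uW; rewrite /= => /and3P[].
rewrite -(big_map (fun w => word H w) xpredT (fun l =>
  \prod_(x <- l) entry sw sb x)).
by rewrite -big_flatten WE !big_cat !big_cons /= !mulrA.
Qed.

(** Up to the factor [q ^+ 2], these are the expressions [da - q^-1 cb] and [ad - q bc] of the
    quantum determinant of the minor. *)
Lemma quantum_swap (r r' k l : 'I_n) : (r < r')%N -> (k < l)%N ->
  q ^+ 2 *: (Phi e r' l * Phi e r k) - q *: (Phi e r' k * Phi e r l) =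
  q ^+ 2 *: (Phi e r k * Phi e r' l - q *: (Phi e r l * Phi e r' k)).
Proof.
move=> rr kl; have /= [_ [bc da]] := qPhi e rr kl.
rewrite -bc; set x := Phi e r k * _ in da *; set y := Phi e r' l * _ in da *.
set z := _ * _ in bc da *.
have -> : y = x - (q - q^-1) *: z by rewrite -da opprB addrC subrK.
rewrite !scalerBr !scalerA.
have -> : q ^+ 2 * (q - q^-1) = q ^+ 2 * q - q by field.
by rewrite scalerBl opprB addrA addrAC addrK.
Qed.

(* The four terms are the four products in a quantum 2 x 2 minor. *)
Lemma term_swap sw sb : (wcol sw c < wcol sw d)%N -> (bcol sb c < bcol sb d)%N ->
  term (wswap c d sw) sb + term (wswap c d sw) (bswap c d sb) =
  q ^+ 2 *: (term sw sb + term sw (bswap c d sb)).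
Proof.
move=> ltw ltb; have [s1 [s2 [c12 d12 prodE]]] := prod_entries.
have iw : inv_total (wswap c d sw) = (inv_total sw).+1 by apply: inv_total_swap.
have ib : inv_total (bswap c d sb) = (inv_total sb).+1 by apply: inv_total_swap.
pose sws := [:: sw; wswap c d sw]; pose sbs := [:: sb; bswap c d sb].
have fixed x : x \in s1 ++ s2 -> tperm c d x = x.
  move=> xs; rewrite tpermD //; first by apply: contraNneq c12 => ->.
  by apply: contraNneq d12 => ->.
have entryE sw' sb' x : sw' \in sws -> sb' \in sbs -> x \in s1 ++ s2 ->
    entry sw' sb' x = entry sw sb x.
  move=> sw'P sb'P /fixed xs; rewrite /web_entry.
  have -> : wcol sw' x = wcol sw x.
    by move: sw'P; rewrite !inE => /orP[]/eqP-> //; rewrite wcol_swap xs.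
  by move: sb'P; rewrite !inE => /orP[]/eqP-> //; rewrite bcol_swap xs.
have {prodE} prodE sw' sb' : sw' \in sws -> sb' \in sbs ->
    \prod_(w < N) \prod_(x <- word H w) entry sw' sb' x =
    \prod_(x <- s1) entry sw sb x * (entry sw' sb' c * entry sw' sb' d)
    * \prod_(x <- s2) entry sw sb x.
  move=> sw'P sb'P; rewrite prodE; congr (_ * _ * _).
    rewrite big_seq [RHS]big_seq; apply: eq_bigr => x xs.
    by apply: entryE; rewrite // mem_cat xs.
  rewrite big_seq [RHS]big_seq; apply: eq_bigr => x xs.
  by apply: entryE; rewrite // mem_cat xs orbT.
rewrite /web_term iw ib !prodE ?inE ?eqxx ?orbT //.
rewrite /web_entry !wcol_swap !bcol_swap !tpermL !tpermR /=.
set X := \prod_(x <- s1) _; set Y := \prod_(x <- s2) _.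
have := quantum_swap ltw ltb.
set D := _ * _; set C := _ * _; set a := Phi e _ _ * _; set b := _ * _ => quad.
have LZ u z : X * (u *: z) * Y = u *: (X * z * Y) by rewrite -scalerAr -scalerAl.
have {}quad : q ^+ 2 *: (X * D * Y) - q *: (X * C * Y) =
    q ^+ 2 *: (X * a * Y - q *: (X * b * Y)).
  have LB u v : X * (u - v) * Y = X * u * Y - X * v * Y by rewrite mulrBr mulrBl.
  by have := congr1 (fun z => X * z * Y) quad; rewrite !(LB, LZ).
(* Each exchange adds one inversion, so the four terms carry [p] times [1], [- q], [- q] and
   [q ^+ 2]: the coefficients in [quantum_swap]. *)
rewrite !(addSn, addnS) !(exprS (- q)).
set p := (- q) ^+ _.
transitivity (p *: (q ^+ 2 *: (X * D * Y) - q *: (X * C * Y))).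
  rewrite scalerBr !scalerA addrC -scaleNr; congr (_ *: _ + _ *: _); ring.
rewrite quad scalerA scalerBr scalerA scalerDr !scalerA -scaleNr;
  congr (_ *: _ + _ *: _); ring.
Qed.

(** Black colourings are paired by exchanging the same two copies, and [term_swap] applies to each
    pair. *)
Lemma row_sum_swap sw : (wcol sw c < wcol sw d)%N ->
  row_sum (wswap c d sw) = q ^+ 2 *: row_sum sw.
Proof.
move=> ltw; have sumE sw' : row_sum sw' =
    \sum_(sb | (bcol sb c < bcol sb d)%N) (term sw' sb + term sw' (bswap c d sb)).
  rewrite /row_sum (bigID (fun sb => bcol sb c < bcol sb d)%N) /= big_split /=.
  have bK : involutive (bswap c d) by apply: swapK.
  congr (_ + _); rewrite (reindex_inj (inv_inj bK)) /=.
  apply: eq_bigl => sb; rewrite !bcol_swap tpermL tpermR -leqNgt leq_eqVlt.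
  case: eqVneq => // /val_inj cd; have : c = d by apply: color_inj cd.
  by move/Tagged_copy_inj => ij; move: ji; rewrite ij; lia.
rewrite !sumE scaler_sumr; apply: eq_bigr => sb ltb.
exact: term_swap.
Qed.

End SwapCopies.

(* Colour of the copy number [a] of [e]; the value [0] for [m e <= a] is a dummy. *)
Definition copy_color (e : edge G) (sw : config) (a : nat) : nat :=
  if insub a is Some i then wcol sw (@copy e i) else 0%N.

Let copy_swap (e : edge G) (a : nat) (sw : config) : config :=
  if insub a is Some i then
    if insub a.+1 is Some j then wswap (@copy e i) (@copy e j) sw else sw
  else sw.

Definition increasing_on (e : edge G) (sw : config) : bool :=
  increasing_upto (copy_color e) (m e) sw.

Lemma increasing_onP e sw :
  reflect (forall i j : 'I_(m e), (i < j)%N ->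
             (wcol sw (copy i) < wcol sw (copy j))%N) (increasing_on e sw).
Proof.
apply: (iffP (increasing_uptoP _ _ _)) => [inc i j ij|inc a b ab bm].
  by have := inc i j ij (ltn_ord j); rewrite /copy_color !valK.
have am := ltn_trans ab bm.
by rewrite /copy_color !insubT; apply: inc.
Qed.

Definition sorting_factor (k : nat) : R[i] :=
  \prod_(0 <= a < k) \sum_(0 <= t < a.+1) (q ^+ 2) ^+ t.

Lemma sum_sorted_edge (P : pred config) e :
    (forall (i j : 'I_(m e)) sw, P (wswap (copy i) (copy j) sw) = P sw) ->
  \sum_(sw | P sw) row_sum sw =
    sorting_factor (m e) *: \sum_(sw | P sw && increasing_on e sw) row_sum sw.
Proof.
move=> P_swap; apply: (@sum_sorted _ _ _ _ _ _ (copy_swap e)).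
- move=> a am x; have am' := ltnW am.
  by rewrite /copy_swap !insubT; apply: swapK.
- move=> a x b am bm; have am' := ltnW am; rewrite /copy_swap !insubT.
  rewrite /copy_color insubT wcol_swap.
  case: tpermP => [[]|[]|].
  + by move=> ->; rewrite eqxx insubT.
  + by move=> ->; rewrite (gtn_eqF (ltnSn a)) eqxx insubT.
  + move=> nb nb1; have /negPf-> : b != a by apply: contra_not_neq nb => ba;
    congr copy; apply: val_inj.
    have /negPf-> : b != a.+1 by apply: contra_not_neq nb1 => ba; congr copy;
      apply: val_inj.
    by rewrite insubT.
- move=> x a b am bm; rewrite /copy_color !insubT => /val_inj ab.
  have /Tagged_copy_inj[] // : @copy e (Ordinal am) = @copy e (Ordinal bm).
  by apply: color_inj ab.
- move=> a x am; have am' := ltnW am; rewrite /copy_swap !insubT.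
  exact: P_swap.
- move=> a x am; have am' := ltnW am; rewrite /copy_swap /copy_color !insubT.
  by move=> lt; apply: row_sum_swap.
Qed.

(** Sorting the copies of one edge leaves the colours of all other copies alone, so the edges can be
    treated in turn. *)
Lemma sum_row_sorted (s : seq (edge G)) : uniq s ->
  \sum_sw row_sum sw = (\prod_(e <- s) sorting_factor (m e)) *:
    \sum_(sw | all (fun e => increasing_on e sw) s) row_sum sw.
Proof.
elim: s => [_|e s IHs /= /andP[es /IHs ->]]; first by rewrite big_nil scale1r.
rewrite (@sum_sorted_edge _ e) => [|i j sw]; last first.
  apply: eq_in_all => f fs; apply: eq_forallb => b; apply: eq_forallb => a.
  have fe : f != e by apply: contraNneq es => <-.
  have colE c : copy_color f (wswap (copy i) (copy j) sw) c = copy_color f sw c.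
    rewrite /copy_color; case: insub => // k; rewrite wcol_swap tpermD //.
      by apply: contra_neq fe => /(congr1 tag).
    by apply: contra_neq fe => /(congr1 tag).
  by rewrite !colE.
rewrite big_cons scalerA mulrC; congr (_ *: _).
by apply: eq_bigl => sw; rewrite andbC.
Qed.

End Straightening.

(* Factors with different keys commute, and both lists run through the factors
   with a given key in the same order, so no other transposition is needed. *)
Lemma prod_reorder (A : pzRingType) (T E : eqType) (key : T -> E) (rk : T -> nat)
    (F : T -> A) (l1 l2 : seq T) (r := fun s t =>
      (key s == key t) ==> (rk s < rk t)%N) :
    (forall s t, key s != key t -> F s * F t = F t * F s) ->
    perm_eq l1 l2 -> pairwise r l1 -> pairwise r l2 ->
  \prod_(t <- l1) F t = \prod_(t <- l2) F t.
Proof.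
move=> Fcomm; elim: l1 l2 => [|x l1 IHl1] l2 l12.
  by move: l12; rewrite perm_sym => /perm_nilP->.
rewrite pairwise_cons => /andP[xl1 pl1] pl2; rewrite big_cons.
have xl2 : x \in l2 by rewrite -(perm_mem l12) mem_head.
case/splitPr: xl2 l12 pl2 => a b l12 pl2.
have {l12} l12 : perm_eq l1 (a ++ b).
  by rewrite -(perm_cons x) (perm_trans l12) // -cat_rcons -cats1 -catA perm_catCA.
move: pl2; rewrite pairwise_cat allrel_consr pairwise_cons -!andbA.
case/and5P=> ax ab pa xb pb.
rewrite (IHl1 (a ++ b)) //; last by rewrite pairwise_cat ab pa pb.
rewrite !big_cat big_cons /= mulrA [RHS]mulrA; congr (_ * _).
have: {in a, forall y, F x * F y = F y * F x}.
  move=> y ya; apply: Fcomm; apply/negP => xy.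
  have yl1 : y \in l1 by rewrite (perm_mem l12) mem_cat ya.
  have := allP xl1 y yl1; have := allP ax y ya; rewrite /r (eq_sym (key y)) xy /=.
  by move=> yx /ltn_trans-/(_ _ yx); rewrite ltnn.
elim: a {ax ab pa l12} => [|y a IHa] comm; first by rewrite big_nil mulr1 mul1r.
rewrite !big_cons mulrA comm ?mem_head // -!mulrA IHa // => z za.
by apply: comm; rewrite inE za orbT.
Qed.

Lemma pairwise_index (T : eqType) (l : seq T) (r : rel T) : uniq l ->
    {in l &, forall x y, (index x l < index y l)%N -> r x y} -> pairwise r l.
Proof.
move=> ul lr; case: l ul lr => // x0 l ul lr.
apply/(pairwiseP x0) => i j il jl ij.
by apply: lr; rewrite ?mem_nth ?index_uniq.
Qed.

(** * From colourings to matchings *)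

Section WebMatchings.
Variables (R : realType) (q : R[i]) (A : algType R[i]) (n N : nat) (G : cgraph N).
Variables (Phi : edge G -> 'M[A]_n) (m : edge G -> nat).
Hypotheses (cG : ciliated G)
  (sum_m : forall v : vertex N, (\sum_(e | incident e v) m e = n)%N)
  (Phi_comm : forall e e', e != e' -> forall i j k l,
     Phi e i j * Phi e' k l = Phi e' k l * Phi e i j).

Local Notation H := (multiply m).
Local Notation cH := (multiply_ciliated m cG).
Local Notation size_w := (size_word_multiply cG sum_m).
Local Notation size_b := (size_bord_multiply cG sum_m).
Local Notation config := {ffun 'I_N -> 'S_n}.
Local Notation wcol := (@wcolor n N H cH size_w).
Local Notation bcol := (@bcolor n N H cH size_b).

Definition colored_edge (sw sb : config) (c : edge H) : tedge n G :=
  (tag c, bcol sb c, wcol sw c).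

Definition coloring_matching (sw sb : config) : {set tedge n G} :=
  [set colored_edge sw sb c | c : edge H].

Lemma colored_edge_inj sw sb : injective (colored_edge sw sb).
Proof. by move=> c d [tcd _ wcd]; apply: color_inj wcd; rewrite /= tcd. Qed.

Lemma coloring_matched sw sb : exists h : tvertex n N -> edge H,
  [/\ forall x, wh (h x) = x.1 /\ wcol sw (h x) = x.2,
      forall c, h (wh c, wcol sw c) = c
    & matched (coloring_matching sw sb) (colored_edge sw sb \o h)].
Proof.
have [h hE] : exists h : 'I_N * 'I_n -> edge H,
    forall x, wh (h x) = x.1 /\ wcol sw (h x) = x.2.
  exact: color_holder (word_uniq cH) (mem_word cH) size_w sw.
have hK c : h (wh c, wcol sw c) = c.
  by have [hw hc] := hE (wh c, wcol sw c); apply: color_inj hc.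
exists h; split=> //; split.
- apply/setP=> t; apply/imsetP/imsetP => [[c _ ->]|[x _ ->]]; last by exists (h x).
  by exists (wh c, wcol sw c) => //=; rewrite hK.
- move=> x; have [hw hc] := hE x.
  by rewrite /= -[LHS]/(wh (h x), wcol sw (h x)) hw hc -surjective_pairing.
- move=> x y; case=> bxy cxy.
  have hxy : h x = h y by apply: color_inj cxy.
  have [hxw hxc] := hE x; have [hyw hyc] := hE y.
  by apply/eqP; rewrite -[x == y]/(_ && _) -hxw -hyw -hxc -hyc hxy !eqxx.
Qed.

Lemma mult_coloring sw sb e : mult (coloring_matching sw sb) e = m e.
Proof.
rewrite /mult; have -> : [set t in coloring_matching sw sb | tover t == e] =
    [set colored_edge sw sb (Tagged (fun f => 'I_(m f)) i) | i : 'I_(m e)].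
  apply/setP=> t; rewrite inE;
    apply/andP/imsetP => [[/imsetP[[f i] _ ->]]|[i _ ->]].
    by move/eqP=> /= <-; exists i.
  by split; [apply: imset_f | rewrite /= eqxx].
rewrite card_imset ?card_ord // => i j /colored_edge_inj.
exact: Tagged_copy_inj.
Qed.

Definition sorted_coloring (sw : config) : Prop := forall e (i j : 'I_(m e)),
  (i < j)%N ->
  (wcol sw (Tagged (fun f => 'I_(m f)) i) < wcol sw (Tagged (fun f =>
    'I_(m f)) j))%N.

Lemma sorted_coloring_lt sw (c d : copies m) : sorted_coloring sw ->
  tag c = tag d ->
  (tagged c < tagged d)%N = (wcol sw c < wcol sw d)%N.
Proof.
move=> srt; case: c d => [e i] [f j] /= ef; case: f / ef j => j.
case: (ltngtP i j) => [/srt-> //|/srt ji|/ord_inj->]; last by rewrite ltnn.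
by symmetry; apply/negP=> /(ltn_trans ji); rewrite ltnn.
Qed.

(** Sortedness lets the matching remember which copy each of its edges came from, whence
    [coloring_matching_inj]. *)
Lemma index_S_coloring sw sb c : sorted_coloring sw ->
  index (wcol sw c) (enum (S_ (coloring_matching sw sb) (tag c))) = tagged c.
Proof.
move=> srt; case: c => e i /=.
have -> : enum (S_ (coloring_matching sw sb) e) =
    [seq wcol sw (Tagged (fun f => 'I_(m f)) j) | j <- enum 'I_(m e)].
  apply: (@irr_sorted_eq _ (fun x y : 'I_n => (x < y)%N)).
  - by move=> ? ? ?; apply: ltn_trans.
  - by move=> ?; apply: ltnn.
  - exact: sorted_enum_ord.
  - by apply: homo_sorted (sorted_enum_ord _) => j k; apply: srt.
  - move=> k; rewrite mem_enum; apply/imsetP/mapP => [[t + ->]|[j _ ->]].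
      rewrite inE => /andP[/imsetP[[f j] _ ->] /eqP /= fe].
      by case: e / fe i => _; exists j; rewrite ?mem_enum.
    by exists (colored_edge sw sb (Tagged (fun f => 'I_(m f)) j));
      rewrite ?inE ?imset_f /=.
rewrite (@index_map _ _ (fun j => wcol sw (Tagged (fun f =>
  'I_(m f)) j))) ?index_enum_ord //.
by move=> j k jk; apply/Tagged_copy_inj/(color_inj _ jk).
Qed.

Lemma coloring_matching_inj sw sb sw' sb' :
    sorted_coloring sw -> sorted_coloring sw' ->
  coloring_matching sw sb = coloring_matching sw' sb' -> sw = sw' /\ sb = sb'.
Proof.
move=> srt srt' eqm.
have eqc c : colored_edge sw sb c = colored_edge sw' sb' c.
  have /imsetP[d _ cd] : colored_edge sw sb c \in coloring_matching sw' sb'.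
    by rewrite -eqm imset_f.
  suff cdE : c = d by rewrite cd -cdE.
  have tcd : tag c = tag d by case: cd.
  have wcd : wcol sw c = wcol sw' d by case: cd.
  have : tagged c = tagged d :> nat.
    by rewrite -(index_S_coloring sb c srt) -(index_S_coloring sb' d srt') wcd
      eqm tcd.
  case: c d tcd {cd wcd} => [e i] [f j] /= ef; case: f / ef j => j.
  by move/ord_inj => ->.
split.
  by apply: (@color_ext _ _ _ _ _ (word_uniq cH) (mem_word cH) size_w) => c;
    case: (eqc c).
by apply: (@color_ext _ _ _ _ _ (bord_uniq cH) (mem_bord cH) size_b) => c;
  case: (eqc c).
Qed.

Lemma coloring_matching_surj (M : {set tedge n G}) : tmatching M ->
  (forall e, mult M e = m e) ->
  exists sw sb, sorted_coloring sw /\ coloring_matching sw sb = M.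
Proof.
case/tmatchingP=> mu mu_m multM.
have cardS e : #|S_ M e| = m e.
  rewrite -multM /S_ /mult (@card_in_imset _ _ (@tw n N G)) => [|s t].
    by apply: eq_card => t; rewrite !inE.
  rewrite !inE => /andP[sM /eqP se] /andP[tM /eqP te] st.
  move: sM tM; rewrite !(mem_matched mu_m) => /eqP-> /eqP->; congr mu.
  by rewrite /twh se te st.
(* The copies of an edge are numbered by increasing white index of the matching edges over it; this
   is the only sorted choice. *)
pose wf (c : edge H) : 'I_n := enum_val (cast_ord (esym (cardS (tag c)))
  (tagged c)).
pose bf (c : edge H) : 'I_n := tb (mu (wh (tag c), wf c)).
have wfS (c : edge H) : wf c \in S_ M (tag c) by apply: enum_valP.
have over_wf (c : edge H) : tover (mu (wh (tag c), wf c)) = tag c.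
  by have := wfS c; rewrite (mem_S_ mu_m) => /eqP.
have wf_inj c d : wh c = wh d -> wf c = wf d -> c = d.
  move=> wcd fcd; have tcd : tag c = tag d.
    by rewrite -over_wf -[RHS]over_wf fcd; congr (tover (mu (_, _))).
  move: fcd {wcd}; case: c d tcd => [e i] [f j] /= ef; case: f / ef j => j.
  by rewrite /wf /= => /enum_val_inj/cast_ord_inj->.
have [sw swE] := color_complete (word_uniq cH) (mem_word cH) size_w wf_inj.
have bf_inj c d : bl c = bl d -> bf c = bf d -> c = d.
  move=> bcd fcd; case: mu_m => _ _ mu_inj.
  have /mu_inj[wcd] : tbl (mu (wh (tag c), wf c)) = tbl (mu (wh (tag d), wf d)).
    by rewrite /tbl !over_wf; congr (_, _).
  exact: wf_inj.
have [sb sbE] := color_complete (bord_uniq cH) (mem_bord cH) size_b bf_inj.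
exists sw, sb; split=> [e i j ij|].
  rewrite /wcolor !swE /wf /= -(index_enum_lt (enum_valP _) (enum_valP _)).
  by rewrite !index_enum_val.
have teE c : colored_edge sw sb c = mu (wh (tag c), wf c).
  rewrite /colored_edge /wcolor /bcolor swE sbE /bf.
  have := over_wf c; have := tw_matched mu_m (wh (tag c), wf c).
  by case: (mu _) => -[f k] l; rewrite /tover /tw /tb /= => -> ->.
apply/setP=> t; apply/imsetP/idP => [[c _ ->]|tM].
  by rewrite teE (mem_matched mu_m) (twh_matched mu_m).
have twS : tw t \in S_ M (tover t) by apply: imset_f; rewrite inE tM /=.
pose i := cast_ord (cardS (tover t)) (enum_rank_in twS (tw t)).
exists (Tagged (fun f => 'I_(m f)) i) => //;
  rewrite teE /wf /i /= cast_ordK enum_rankK_in //.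
by move: tM; rewrite (mem_matched mu_m) => /eqP.
Qed.

(** Inversions between copies of distinct edges are those of [vsigma]. Among copies of one edge
    there are none at the white end; at the black end, the copies being in the order of their white
    colours, they are the inversions of [esigma]. *)
Lemma inv_total_coloring sw sb (M := coloring_matching sw sb) : sorted_coloring
  sw ->
  (inv_total sw + inv_total sb =
   \sum_v inv_count (vsigma M v) + \sum_e inv_count (esigma M e))%N.
Proof.
move=> srt; have [h [hE hK M_m]] := coloring_matched sw sb.
have lt_tagged x y : tag (h x) = tag (h y) ->
    (tagged (h x) < tagged (h y))%N = (x.2 < y.2)%N.
  by move=> hxy; rewrite (sorted_coloring_lt srt) // (hE x).2 (hE y).2.
pose B := black_end M_m.
pose g x := h (B^-1%g x).
have gE x : bl (g x) = x.1 /\ bcol sb (g x) = x.2.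
  have Bh : B (B^-1%g x) = (bl (g x), bcol sb (g x)) by rewrite black_endE.
  rewrite permKV in Bh; by split;
    [apply: (congr1 fst (esym Bh)) | apply: (congr1 snd (esym Bh))].
rewrite /M big_sumType /= addnC [RHS]addnAC; congr (_ + _)%N; last first.
  apply: eq_bigr => w _; rewrite (inv_vsigma_white cG M_m) (inv_count_color w hE).
  apply: eq_bigr => k _; apply: eq_bigr => l _;
    rewrite /pos (hE (w, k)).1 (hE (w, l)).1 /=.
  have hw z : tag (h (w, z)) \in word G w by rewrite mem_word //; apply/eqP;
    apply: (hE (w, z)).1.
  rewrite index_copies_list //; congr nat_of_bool.
  case: ltnP => //= _; case: eqP => //= /lt_tagged -> /=.
  by case: ltngtP.
rewrite (sum_inv_esigma M_m) /=.
(* The inversions of [esigma], indexed by white ends, are reindexed by black ends through [B] and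
   grouped by black vertex. *)
have -> : (\sum_x \sum_y [&& tag (h x) == tag (h y), x.2 < y.2 &
      bcol sb (h y) < bcol sb (h x)] =
    \sum_b \sum_(k < n) \sum_(l < n) [&& tag (g (b, k)) == tag (g (b, l)),
      tagged (g (b, k)) < tagged (g (b, l)) & l < k])%N.
  pose Q x y : nat := [&& tag (g x) == tag (g y),
    tagged (g x) < tagged (g y) & y.2 < x.2]%N.
  have gB x : g (B x) = h x by rewrite /g permK.
  have B2 x : (B x).2 = bcol sb (h x) by rewrite -(gE (B x)).2 gB.
  transitivity (\sum_x \sum_y Q (B x) (B y))%N.
    apply: eq_bigr => x _; apply: eq_bigr => y _; rewrite /Q !gB !B2.
    by case: eqP => //= /lt_tagged ->.
  have reB (F : tvertex n N -> nat) : (\sum_x F x = \sum_x F (B x))%N.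
    exact: (reindex_inj (@perm_inj _ B)).
  rewrite -(reB (fun x => \sum_y Q x (B y)))%N.
  rewrite big_pairE; apply: eq_bigr => b _; apply: eq_bigr => k _.
  rewrite -(reB (Q (b, k))) big_pairE (bigD1 b) //=.
  rewrite [X in (_ + X)%N]big1 ?addn0 // => b' b'b; rewrite big1 // => l _.
  rewrite /Q; case: eqP => // gg; case/eqP: b'b.
  by have /= <- := (gE (b, k)).1; have /= <- := (gE (b', l)).1; rewrite gg.
rewrite -big_split; apply: eq_bigr => b _ /=.
rewrite (inv_vsigma_black cG M_m) (inv_count_color b gE).
rewrite -big_split; apply: eq_bigr => k _; rewrite -big_split;
  apply: eq_bigr => l _ /=.
have gb z : tag (g (b, z)) \in bord G b by rewrite mem_bord //; apply/eqP;
  apply: (gE (b, z)).1.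
have posE z : pos (@bl N H) (@bord N H) (g (b, z)) =
  index (g (b, z)) (copies_list m (bord G b)).
  by rewrite /pos (gE (b, z)).1.
rewrite [pos _ _ (g (b, k))](posE k) [pos _ _ (g (b, l))](posE l)
  index_copies_list //.
have edgeE z : tover (colored_edge sw sb (h ((black_end M_m)^-1%g (b, z)))) =
  tag (g (b, z)) by [].
rewrite !edgeE.
case: (eqVneq (tag (g (b, k))) (tag (g (b, l)))) => [gg|_].
  have -> // : (index (tag (g (b, k))) (bord G b) < index (tag (g (b, l)))
    (bord G b))%N = false.
  by rewrite gg ltnn.
by rewrite orbF addn0.
Qed.

(** At a white vertex one product follows the half-edges, the other the indices of the blow-up.
    Factors over distinct edges commute, and over a single edge sortedness makes the two orders
    agree. *)
Lemma term_coloring sw sb (M := coloring_matching sw sb) : sorted_coloring sw ->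
  web_term q (fun c : edge H => Phi (tag c)) cH size_w size_b sw sb =
  (- q) ^+ (\sum_v inv_count (vsigma M v) + \sum_e inv_count (esigma M e)) *:
    \prod_(i < N) \prod_(l < n)
      oapp (fun t => Phi (tover t) (tw t) (tb t)) 0 (mate M (i, l)).
Proof.
move=> srt; rewrite /web_term inv_total_coloring //; congr (_ *: _).
have [h [hE hK M_m]] := coloring_matched sw sb.
apply: eq_bigr => w _.
pose F (t : tedge n G) := Phi (tover t) (tw t) (tb t).
rewrite -(big_map (colored_edge sw sb) xpredT F).
rewrite (eq_bigr (fun l => F (colored_edge sw sb (h (w, l))))) => [|l _];
  last first.
  by rewrite (mate_matched M_m).
rewrite -[RHS](big_map (fun l => colored_edge sw sb (h (w, l))) xpredT F).
apply: (@prod_reorder _ _ _ (@tover n N G) (fun t => tw t : nat)).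
- by move=> s t st; apply: Phi_comm.
- apply: uniq_perm.
  + by rewrite map_inj_uniq ?(word_uniq cH w) //; apply: colored_edge_inj.
  + rewrite map_inj_uniq ?index_enum_uniq // => k l /colored_edge_inj kl.
    by have := (hE (w, k)).2; rewrite kl (hE (w, l)).2.
  + move=> t; apply/mapP/mapP => [[c cw ->]|[l _ ->]].
      exists (wcol sw c); first by rewrite mem_index_enum.
      by move: cw; rewrite (mem_word cH) => /eqP <-; rewrite hK.
    exists (h (w, l)) => //; rewrite (mem_word cH).
    by apply/eqP; apply: (hE (w, l)).1.
- rewrite pairwise_map; apply: pairwise_index => [|c d];
  first exact: (word_uniq cH w).
  rewrite /= !mem_copies_list => cw dw; rewrite index_copies_list //.
  move=> /orP lt; apply/implyP => /eqP tcd; rewrite -(sorted_coloring_lt srt) //.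
  rewrite /tover /= in tcd; case: lt => [lt|/andP[_ //]].
  by rewrite tcd ltnn in lt.
- rewrite pairwise_map; apply: pairwise_index => [|k l _ _];
  first exact: index_enum_uniq.
  rewrite -[index_enum _]enumT !index_enum_ord => kl; apply/implyP => _.
  by rewrite /tw /= (hE (w, k)).2 (hE (w, l)).2.
Qed.

End WebMatchings.

(** * Multiplicities and coefficients of matchings *)

Section Mult.
Variables (n N : nat) (G : cgraph N) (M : {set tedge n G}).

Lemma multE mu e : matched M mu -> mult M e = (\sum_x (tover (mu x) == e))%N.
Proof.
move=> M_m; rewrite /mult -sum1_card (eq_bigl (fun t =>
  (t \in M) && (tover t == e))) => [|t]; last first.
  by rewrite inE.
case: M_m => -> muK _; rewrite big_mkcondr big_imset /=;
  last by move=> x y _ _; apply: (can_inj muK).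
by apply: eq_bigr => x _; case: eqP.
Qed.

Lemma sum_mult (V : nmodType) mu (g : edge G -> V) : matched M mu ->
  \sum_e g e *+ mult M e = \sum_x g (tover (mu x)).
Proof.
move=> M_m; rewrite [RHS](partition_big (fun x => tover (mu x)) predT) //=.
apply: eq_bigr => e _; rewrite (multE e M_m).
rewrite -sumrMnr [RHS]big_mkcond; apply: eq_bigr => x _.
by case: eqP => // ->.
Qed.

Lemma mult_multiweb v : tmatching M -> (\sum_(e | incident e v) mult M e = n)%N.
Proof.
case/tmatchingP=> mu M_m.
have -> : (\sum_(e | incident e v) mult M e = \sum_x incident (tover (mu x)) v)%N.
  rewrite -(sum_mult (fun e => incident e v : nat) M_m) big_mkcond.
  apply: eq_bigr => e _; case: incident; rewrite ?mul0rn //.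
  by rewrite -[RHS]mulr_natr mul1r natn.
have fst_sum (u : 'I_N) : (\sum_(x : tvertex n N) (x.1 == u) = n)%N.
  rewrite big_pairE (bigD1 u) //= eqxx sum1_card card_ord big1 ?addn0 // =>
    w /negPf->.
  by rewrite big1.
rewrite -[RHS](fst_sum (match v with inl b => b | inr w => w end)).
case: v => v; last by apply: eq_bigr => x _; rewrite /= (wh_matched M_m).
rewrite [RHS](reindex_inj (@perm_inj _ (black_end M_m))).
by apply: eq_bigr => x _; rewrite /= (bl_matched M_m).
Qed.

Lemma mult_leq e : tmatching M -> (mult M e < n.+1)%N.
Proof.
move=> tM; rewrite ltnS -[leqRHS](mult_multiweb (inl (bl e)) tM) (bigD1 e) //=.
exact: leq_addr.
Qed.

End Mult.

Section Signs.
Variables (R : realType) (q : R[i]) (n N : nat) (G : cgraph N).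
Variables (outer : {set {set dart G}}) (eps : edge G -> int).
Hypotheses (cG : ciliated G) (pG : plane outer) (kG : kasteleyn n outer eps).
Implicit Types M : {set tedge n G}.

Definition inversions M : nat :=
  (\sum_v inv_count (vsigma M v) + \sum_e inv_count (esigma M e))%N.

Definition web_coef M : R[i] := (- q) ^+ inversions M * \prod_e q ^+ 'C(mult M
  e, 2).

Definition kasteleyn_coef M : R[i] :=
  (-1) ^+ (tsigma M : bool)
  * (\prod_(v : vertex N) q ^+ inv_count (vsigma M v))
  * (\prod_(e : edge G) (q ^+ 'C(mult M e, 2) * q ^+ inv_count (esigma M e)))
  * (\prod_(x : tvertex n N) oapp (fun t => (eps (tover t))%:~R) 1 (mate M x)).

Definition negative_edges M : nat :=
  (\sum_x (if mate M x is Some t then (eps (tover t) == -1)%R else false))%N.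

(** The summand [inversions] arises because the trace has powers of [- q] where the determinant has
    powers of [q]. *)
Definition sign_count M : nat := (tsigma M + inversions M + negative_edges M)%N.

Lemma kasteleyn_coefE M : tmatching M ->
  kasteleyn_coef M = (-1) ^+ sign_count M * web_coef M.
Proof.
case/tmatchingP=> mu M_m;
  rewrite /kasteleyn_coef /web_coef /sign_count /inversions !exprD.
rewrite big_split /= -!expr_sum.
have -> : \prod_x oapp (fun t => (eps (tover t))%:~R) 1 (mate M x) =
    (-1) ^+ negative_edges M :> R[i].
  rewrite /negative_edges expr_sum; apply: eq_bigr => x _.
  by rewrite (mate_matched M_m) /=; case: (kG.1 (tover (mu x))) => ->.
rewrite !(exprNn q).
have sgn1 k : (-1) ^+ k * (-1) ^+ k =
  1 :> R[i] by rewrite -exprMn mulrNN mulr1 expr1n.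
have := sgn1 (\sum_v inv_count (vsigma M v))%N.
have := sgn1 (\sum_e inv_count (esigma M e))%N.
set a := (-1) ^+ _; set Qv := q ^+ _; set Qm := q ^+ _; set Qe := q ^+ _.
set b := (-1) ^+ _; set c := (-1) ^+ _; set d := (-1) ^+ _ => aa bb.
transitivity (c * (b * b) * (a * a) * d * (Qv * Qe) * Qm); last by ring.
by rewrite aa bb; ring.
Qed.

Lemma sign_count_web_sign M : tmatching M ->
  (sign_count M)%:R = web_sign eps (fun e => (mult M e)%:R).
Proof.
case/tmatchingP=> mu M_m; rewrite /sign_count /inversions !natrD.
rewrite [(_ : bool)%:R + _]addrA (tsigma_sign cG M_m) /web_sign; congr (_ + _).
rewrite natr_sum (eq_bigr (fun x => sign_bit (eps (tover (mu x))))) => [|x _];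
  last first.
  by rewrite (mate_matched M_m).
rewrite -(sum_mult (fun e => sign_bit (eps e)) M_m).
by apply: eq_bigr => e _; rewrite mulr_natl.
Qed.

Lemma sign_count_constant M M' : tmatching M -> tmatching M' ->
  odd (sign_count M) = odd (sign_count M').
Proof.
move=> tM tM'; apply: F2_odd_inj; rewrite !sign_count_web_sign //.
by apply: (web_sign_constant cG pG kG) => v; rewrite -natr_sum mult_multiweb.
Qed.

End Signs.

(** * Quantum factorials *)

Section QuantumFactorials.
Variables (R : realType) (q : R[i]) (n : nat).
Hypothesis q_adm : admissible q n.

Lemma qint_shift k : \sum_(0 <= t < k.+1) (q ^+ 2) ^+ t = q ^+ k * qint q k.+1.
Proof.
case: q_adm => q0 _; rewrite /qint big_add1 mulr_sumr; apply: eq_big_nat => t _.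
rewrite -exprM !exprnP -expfzDr //; congr (_ ^ _); lia.
Qed.

(** Sorting yields geometric sums in [q ^+ 2] starting at exponent 0, while [qint] is symmetric
    about 0; the shifts by [q ^+ k] accumulate to the binomial power. *)
Lemma sorting_factor_qfact k : sorting_factor q k = q ^+ 'C(k, 2) * qfact q k.
Proof.
elim: k => [|k IHk]; first by rewrite /sorting_factor /qfact !big_geq // mulr1.
rewrite /sorting_factor big_nat_recr //= -/(sorting_factor q k) IHk qint_shift.
rewrite /qfact [in RHS]big_nat_recr //= binS bin1 exprD; ring.
Qed.

(** A vanishing factor is a vanishing geometric sum in [q ^+ 2], which forces a power of [q ^+ 2] to
    be 1; if [q ^+ 2 = 1] the sum is a positive integer. *)
Lemma qfact_neq0 k : (k <= n)%N -> qfact q k != 0.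
Proof.
case: q_adm => q0 adm kn; rewrite /qfact prodf_seq_neq0; apply/allP => j.
rewrite mem_index_iota => /andP[j0 jk]; apply/implyP=> _.
case: j j0 jk => // j _ jk.
suff : \sum_(0 <= t < j.+1) (q ^+ 2) ^+ t != 0.
  by rewrite qint_shift mulf_eq0 negb_or => /andP[].
have sum1 : q ^+ 2 = 1 -> \sum_(0 <= t < j.+1) (q ^+ 2) ^+ t != 0.
  move=> ->; rewrite (eq_bigr (fun=> 1)) => [|t _]; last exact: expr1n.
  by rewrite sumr_const_nat subn0 Num.Theory.pnatr_eq0.
case: adm => [q1|[q1|adm]]; first by apply: sum1; rewrite q1 expr1n.
  by apply: sum1; rewrite q1 sqrrN expr1n.
(* The first factor is [[1] = 1], which lies below the range [2 <= m] of [admissible]. *)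
case: j jk sum1 => [|j] jk sum1; first by rewrite big_nat1 oner_eq0.
have /(adm _) : (2 <= j.+2 <= n)%N by lia.
apply: contra_neq => s0; apply/eqP.
by rewrite exprM -subr_eq0 subrX1 -(big_mkord predT (fun t =>
  (q ^+ 2) ^+ t)) s0 mulr0.
Qed.

End QuantumFactorials.

(** * The partition function as a sum over matchings *)

Section TraceMatchings.
Variables (R : realType) (q : R[i]) (A : algType R[i]) (n N : nat) (G : cgraph N).
Variable Phi : edge G -> 'M[A]_n.
Hypotheses (q_adm : admissible q n) (cG : ciliated G) (qPhi :
  quantum_connection q Phi).

Definition matching_prod (M : {set tedge n G}) : A :=
  \prod_(i < N) \prod_(l < n) oapp (fun t =>
    Phi (tover t) (tw t) (tb t)) 0 (mate M (i, l)).

Lemma trace_multiweb_matchings (m : {ffun edge G -> 'I_n.+1}) : multiweb m ->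
  trace_multiweb q Phi m =
  \sum_(M | tmatching M && [forall e, mult M e == m e]) web_coef q M *:
    matching_prod M.
Proof.
move=> /forallP web_m; pose mf e : nat := m e.
have sum_m (v : vertex N) : (\sum_(e | incident e v) mf e = n)%N by apply/eqP;
  apply: web_m.
have q0 : q != 0 by case: q_adm.
rewrite /trace_multiweb (trace_graph_web_term _ _ (multiply_ciliated mf cG)
  (size_word_multiply cG sum_m) (size_bord_multiply cG sum_m)).
have := sum_row_sorted q0 cG sum_m qPhi.1 (index_enum_uniq (edge G)).
rewrite /row_sum => ->; rewrite scalerA.
pose inc (sw : {ffun 'I_N ->
  'S_n}) := all (fun e => increasing_on cG sum_m e sw) (index_enum (edge G)).
have incP sw : reflect (sorted_coloring cG sum_m sw) (inc sw).
  apply: (iffP allP) => [inc_sw e|srt e _]; last by apply/increasing_onP/srt.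
  by apply/increasing_onP/inc_sw; rewrite mem_index_enum.
(* The quantum factorials cancel, leaving the powers of [q] that [Kdet] attaches to
   multiplicities. *)
have -> : (\prod_e qfact q (m e))^-1 * \prod_e sorting_factor q (mf e) =
    \prod_e q ^+ 'C(m e, 2).
  rewrite -prodfV -big_split; apply: eq_bigr => e _ /=.
  by rewrite (sorting_factor_qfact q_adm) mulrC mulfK // (qfact_neq0 q_adm) //
    -ltnS ltn_ord.
pose D := [set p : {ffun 'I_N -> 'S_n} * {ffun 'I_N -> 'S_n} | inc p.1].
pose h (p : {ffun 'I_N -> 'S_n} * {ffun 'I_N ->
  'S_n}) := coloring_matching cG sum_m p.1 p.2.
transitivity (\sum_(M in h @: D) web_coef q M *: matching_prod M); last first.
  apply: eq_bigl => M; symmetry.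
  apply/andP/imsetP => [[tM /forallP multM]|[[sw sb] _ ->]].
    have [e|sw [sb [srt <-]]] := @coloring_matching_surj _ _ _ _ cG sum_m M tM.
      exact/eqP/multM.
    by exists (sw, sb) => //; rewrite inE; apply/incP.
  split; last by apply/forallP => e; rewrite mult_coloring.
  have [g [_ _ M_m]] := coloring_matched cG sum_m sw sb.
  by apply/tmatchingP; eexists; apply: M_m.
rewrite big_imset /=; last first.
  move=> [sw sb] [sw' sb']; rewrite !inE => /incP/= srt /incP/= srt';
    rewrite /h /= => eqm.
  by have [-> ->] := coloring_matching_inj srt srt' eqm.
rewrite (eq_bigl (fun p => inc p.1 && true)) => [|p]; last by rewrite inE andbT.
rewrite -(pair_big inc predT (fun sw sb =>
  web_coef q (coloring_matching cG sum_m sw sb) *: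
  matching_prod (coloring_matching cG sum_m sw sb))) /=.
rewrite scaler_sumr; apply: eq_bigr => sw /incP srt; rewrite scaler_sumr.
apply: eq_bigr => sb _; rewrite term_coloring // ?scalerA; last exact: qPhi.2.
congr (_ *: _); rewrite /web_coef mulrC; congr (_ * _).
by apply: eq_bigr => e _; rewrite mult_coloring.
Qed.

Lemma Zq_matchings :
  Zq q Phi = q ^- (N * 'C(n, 2)) *: \sum_(M | tmatching M) web_coef q M *:
    matching_prod M.
Proof.
rewrite /Zq; congr (_ *: _).
(* Matchings are grouped by multiplicities; [inord] alters none of them, by [mult_leq]. *)
pose web (M : {set tedge n G}) : {ffun edge G ->
  'I_n.+1} := [ffun e => inord (mult M e)].
rewrite [RHS](partition_big web (fun m => multiweb m)) => [|M tM] /=; last first.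
  apply/forallP => v; rewrite -[X in _ == X](mult_multiweb v tM); apply/eqP.
  by apply: eq_bigr => e _; rewrite ffunE inordK ?mult_leq.
apply: eq_bigr => m web_m; rewrite trace_multiweb_matchings //; apply: eq_bigl => M.
case tM: (tmatching M) => //=; apply/forallP/eqP => [multM|<- e].
  by apply/ffunP => e; rewrite ffunE (eqP (multM e)) inord_val.
by rewrite ffunE inordK ?mult_leq.
Qed.

End TraceMatchings.

Theorem theorem3 (R : realType) (n N : nat) (q : R[i]) (G : cgraph N)
    (outer : {set {set dart G}}) (eps : edge G -> int)
    (A : algType R[i]) (Phi : edge G -> 'M[A]_n) :
  (0 < n)%N ->
  admissible q n ->
  ciliated G ->
  plane outer ->
  matching_covered G ->
  kasteleyn n outer eps ->
  quantum_connection q Phi ->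
  Zq q Phi = Kdet q eps Phi \/ Zq q Phi = - Kdet q eps Phi.
Proof.
move=> _ q_adm cG pG _ kG qPhi; rewrite (Zq_matchings q_adm cG qPhi).
have KdetE : Kdet q eps Phi = q ^- (N * 'C(n, 2)) *:
    \sum_(M | tmatching M) kasteleyn_coef q eps M *: matching_prod Phi M by [].
(* The sign of a reference matching [M0] is the global sign; without any matching both sums are
   empty. *)
case: (pickP (@tmatching n N G)) => [M0 tM0|no_matching]; last first.
  by left; rewrite KdetE !big_pred0.
have coefE (M : {set tedge n G}) : tmatching M ->
    kasteleyn_coef q eps M = (-1) ^+ sign_count eps M0 * web_coef q M.
  move=> tM; rewrite (kasteleyn_coefE q kG tM) -signr_odd -[in RHS]signr_odd.
  by rewrite (sign_count_constant cG pG kG tM tM0).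
have -> : Kdet q eps Phi = (-1) ^+ sign_count eps M0 *: (q ^- (N * 'C(n, 2)) *:
    \sum_(M | tmatching M) web_coef q M *: matching_prod Phi M).
  rewrite KdetE scalerA mulrC -scalerA; congr (_ *: _); rewrite scaler_sumr.
  by apply: eq_bigr => M tM; rewrite coefE // scalerA.
rewrite -signr_odd; case: (odd _); [right | left].
  by rewrite scaleN1r opprK.
by rewrite scale1r.
Qed.
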